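(* Let $\ell\in\{2,\dots,n\}$, let $G\subset S_n$, $G\ne\{\mathrm{id}\}$, be a group of permutations with $\ell$-local base $\mathcal T$, and let $\mu\in\mathcal P(G)$ be a measure of the set $\mathcal M_{\mathcal T}$. Let $g:G\to\mathbb R$, and write $\mu(h)=\int h\,d\mu$. (a) Let $d=d_T$ or $d=d_H$, and assume that there exists $\beta:G\to\mathbb R^+$ such that for all $\tau,\sigma\in G$, $g(\tau)-g(\sigma)\le\beta(\tau)d(\tau,\sigma)$. Then for all $u\ge0$, $$\mu\left(g\ge\mu(g)+u\right)\le\exp\left(-\frac{2u^2}{K_nc(\ell)^2\sup_{\sigma\in G}\beta(\sigma)^2}\right)$$ and $$\mu\left(g\le\mu(g)-u\right)\le\exp\left(-\frac{2u^2}{K_nc(\ell)^2\min\left(\sup_{\sigma\in G}\beta(\sigma)^2,\,4\mu(\beta^2)\right)}\right),$$ where $c(\ell)=\min(2\ell-1,n)$ if $d=d_H$ and $c(\ell)=2$ if $d=d_T$; and when $\mu=\mu_o$ is the uniform law of an $\ell$-local group $G$, one may take $c(\ell)=\ell$ if $d=d_H$ and $c(\ell)=1$ if $d=d_T$. (b) Assume that either (i) $\mu=\mu_o$ is the uniform law of an $\ell$-local group $G$, in which case $c(\ell)^2=2(\ell-1)^2+2$; or (ii) $G$ is a normal subgroup of $S_n$ and $\mu(\sigma)=\mu(\sigma^{-1})$, $\mu(\sigma)=\mu(t^{-1}\sigma t)$ for all $\sigma\in G$, $t\in S_n$, in which case $c(\ell)^2=8(\ell-1)^2+2$. Assume that $g$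 is a configuration function, i.e. there exist functions $\alpha_k:G\to\mathbb R^+$, $k\in\{1,\dots,n\}$, such that for all $\tau,\sigma\in G$, $$g(\tau)-g(\sigma)\le\sum_{k=1}^n\alpha_k(\tau)\mathbf 1_{\tau(k)\ne\sigma(k)},$$ and put $|\alpha(\sigma)|_2^2=\sum_{k=1}^n\alpha_k(\sigma)^2$. Then, for all $v\ge0$, $\lambda\ge0$, $$\mu\left(g\ge\mu(g)+v+\frac{\lambda c(\ell)^2|\alpha|_2^2}{2}\right)\le e^{-\lambda v},$$ and for all $u\ge0$, $$\mu\left(g\le\mu(g)-u\right)\le\exp\left(-\frac{u^2}{2c(\ell)^2\mu(|\alpha|_2^2)}\right).$$ Moreover, for all $u\ge0$, $$\mu\left(g\ge\mu(g)+u\right)\le\exp\left(-\frac{u^2}{2c(\ell)^2\sup_{\sigma\in G}|\alpha(\sigma)|_2^2}\right),$$ and if there exists $M\ge0$ such that $|\alpha|_2^2\le Mg$, then for all $u\ge0$, $$\mu\left(g\ge\mu(g)+u\right)\le\exp\left(-\frac{u^2}{2c(\ell)^2M(\mu(g)+u)}\right).$$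
   Context: Groups. Let $n\ge2$, $[n]=\{1,\dots,n\}$, and let $S_n$ be the symmetric group on $[n]$, products being compositions: $(\sigma\tau)(i)=\sigma(\tau(i))$. A group of permutations $G$ is a subgroup of $S_n$; $\mathcal P(\cdot)$ denotes the set of probability measures; $\mathbb R^+=[0,\infty)$. $\mathrm{supp}(\sigma)=\{i\in[n]:\sigma(i)\ne i\}$ and $\deg(\sigma)=\#\,\mathrm{supp}(\sigma)$. $G$ is $\ell$-local if for any $\sigma\in G$ and any $i,j\in[n]$ with $\sigma(i)=j$ there exists $\tau\in G$ such that $\mathrm{supp}(\tau)\subset\mathrm{supp}(\sigma)$, $\deg(\tau)\le\ell$ and $\tau(i)=j$. $G$ is normal in $S_n$ if $t^{-1}Gt=G$ for all $t\in S_n$. $\mu_o$ is the uniform probability measure on $G$. Local bases. Put $G_n:=G$ and, for $j\in[n-1]$, $G_j:=\{\sigma\in G:\sigma(j+1)=j+1,\dots,\sigma(n)=n\}$; $O_j:=\{\sigma(j):\sigma\in G_j\}$. A family $\mathcal T=(t_{i_j,j})$ of elements of $G$, indexed by $j\in\{2,\dots,n\}$ and $i_j\in O_j$, is an $\ell$-local base of $G$ if for every $j$ one has $t_{j,j}=\mathrm{id}$ and for every $i_j\in O_j$ with $i_j\neq j$: $t_{i_j,j}\in G_j$, $t_{i_j,j}(i_j)=j$ and $\deg(t_{i_j,j})\le\ell$. Let $U_{\mathcal T}:O_2\times\cdots\times O_n\to G$, $U_{\mathcal T}(i_2,\dots,i_n)=t_{i_2,2}t_{i_3,3}\cdots t_{i_n,n}$.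 The set $\mathcal M_{\mathcal T}$ consists of all push-forward measures $U_{\mathcal T}\#\hat\nu$ with $\hat\nu=\hat\nu_2\otimes\cdots\otimes\hat\nu_n$, $\hat\nu_j\in\mathcal P(O_j)$. $K_n$ is the cardinality of $\{j\in\{2,\dots,n\}:O_j\ne\{j\}\}$. Distances. $d_H(\sigma,\tau)=\deg(\sigma\tau^{-1})=\sum_{i=1}^n\mathbf 1_{\sigma(i)\ne\tau(i)}$; $d_T(\sigma,\tau)$ is the minimal number $k$ of elements $t_1,\dots,t_k$ of $G$ with degree at most $\ell$ such that $\sigma t_1\cdots t_k=\tau$. Convention: when a denominator in one of the exponentials vanishes, the fraction is read as $+\infty$ if $u>0$ and as $0$ if $u=0$. *)

(* Defs.v *)
From mathcomp Require Import all_boot all_order all_algebra all_fingroup.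
From mathcomp Require Import boolp classical_sets reals sequences exp.

Set Implicit Arguments.
Unset Strict Implicit.
Unset Printing Implicit Defensive.

Import Order.TTheory GRing.Theory Num.Theory.

Local Open Scope ring_scope.

(* The set [n] = {1, ..., n} is 'I_n = {0, ..., n-1}; an index j in {2, ..., n}
   is an ordinal j with 0 < j. *)

Section Permutations.
Variable n : nat.
Implicit Types (s t : 'S_n) (i j k : 'I_n) (G : {set 'S_n}) (l : nat).

(* MathComp's product of permutations is (s * t) i = t (s i); perm_comp is the
   composition (s t)(i) = s (t (i)). *)
Definition perm_comp s t : 'S_n := (t * s)%g.

Definition psupp s : {set 'I_n} := [set i | s i != i]%SET.
Definition pdeg s : nat := #|psupp s|.

Definition local_group l G : Prop :=
  forall s, s \in G -> forall i j, s i = j ->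
  exists t, [/\ t \in G, psupp t \subset psupp s, (pdeg t <= l)%N & t i = j].

Definition fix_above G j : {set 'S_n} :=
  [set s in G | [forall k : 'I_n, (j < k)%N ==> (s k == k)]]%SET.

Definition fix_orbit G j : {set 'I_n} := [set (s : 'S_n) j | s in fix_above G j]%SET.

Definition local_base l G (t : 'I_n -> 'I_n -> 'S_n) : Prop :=
  forall j, (0 < j)%N ->
    t j j = 1%g /\
    forall i, i \in fix_orbit G j -> i != j ->
      [/\ t i j \in fix_above G j, t i j i = j & (pdeg (t i j) <= l)%N].

(* The factors appear in increasing order of j from left to right. *)
Definition base_map (t : 'I_n -> 'I_n -> 'S_n) (i : {ffun 'I_n -> 'I_n}) : 'S_n :=
  \big[perm_comp/1%g]_(j < n | (0 < j)%N) t (i j) j.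

Definition K_ G : nat := #|[set j : 'I_n | (0 < j)%N && (fix_orbit G j != [set j]%SET)]%SET|.

Definition dH s t : nat := pdeg (perm_comp s t^-1).

Definition reach l G s t (k : nat) : bool :=
  [exists r : k.-tuple 'S_n,
    all (fun x => (x \in G) && (pdeg x <= l)%N) r && (foldl perm_comp s r == t)].

(* The default value 0 is never used on a group with an l-local base, see
   local_base_reach below. *)
Definition dT l G s t : nat :=
  if pselect (exists k : nat, reach l G s t k) is left ex then ex_minn ex else 0%N.

Lemma dHE s t : dH s t = (\sum_i (s i != t i))%N.
Proof.
rewrite /dH /pdeg /psupp -sum1dep_card big_mkcond /=.
rewrite (reindex_inj (@perm_inj _ t)) /=.
by apply: eq_bigr => i _; rewrite /perm_comp permM permK; case: eqP.
Qed.

(* Hence indexing tuples by all of 'I_n instead of {j | 0 < j} only adds a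
   constant coordinate. *)
Lemma fix_orbit0 (G : {group 'S_n}) j : j = 0%N :> nat -> fix_orbit G j = [set j]%SET.
Proof.
move=> j0; apply/setP => i; rewrite !inE; apply/imsetP/eqP.
  case=> s; rewrite inE => /andP[_ /forallP fs] ->.
  apply/eqP; apply/negPn/negP => sj.
  have lt : (j < s j)%N by rewrite j0 lt0n -j0; exact: sj.
  have := fs (s j); rewrite lt /= => /eqP /perm_inj e.
  by rewrite e eqxx in sj.
move=> ->; exists 1%g; rewrite ?perm1 // inE group1 /=.
by apply/forallP => k; rewrite perm1 eqxx implybT.
Qed.

Lemma local_base_reach l (G : {group 'S_n}) (t : 'I_n -> 'I_n -> 'S_n) :
  local_base l G t -> forall s r, s \in G -> r \in G -> exists k : nat, reach l G s r k.
Proof.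
move=> bt; pose ok x := (x \in G) && (pdeg x <= l)%N.
have H m s : s \in G -> (forall k : 'I_n, (m <= k)%N -> s k = k) ->
    exists r, all ok r && (foldl perm_comp 1%g r == s).
  elim: m s => [|m IH] s sG fs.
    by exists [::] => /=; apply/eqP/permP => k; rewrite perm1 fs.
  have [mn|nm] := ltnP m n; last first.
    by apply: IH => // k mk; have := ltn_ord k; rewrite ltnNge (leq_trans nm).
  pose j := Ordinal mn.
  have [ji|ji] := eqVneq ((s^-1)%g j) j.
    apply: IH => // k; rewrite leq_eqVlt => /orP[/eqP mk|]; last exact: fs.
    have -> : k = j by exact: val_inj.
    by rewrite -{1}ji permKV.
  have iO : (s^-1)%g j \in fix_orbit G j.
    apply/imsetP; exists (s^-1)%g => //; rewrite inE groupV sG /=.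
    by apply/forallP => k; apply/implyP => jk; rewrite -{1}(fs k jk) permK.
  have j0 : (0 < j)%N.
    rewrite lt0n; apply/negP => /eqP e.
    by move: iO ji; rewrite fix_orbit0 // inE => ->.
  have [] := (bt j j0).2 _ iO ji; set x := t _ _ => xf xi xd.
  move: xf; rewrite inE => /andP[xG /forallP fx].
  have [||r /andP[r1 /eqP r2]] := IH (x^-1 * s)%g.
  - by rewrite groupM ?groupV.
  - move=> k; rewrite leq_eqVlt permM => /orP[/eqP mk|mk].
      have -> : k = j by exact: val_inj.
      by rewrite -{1}xi permK permKV.
    have /eqP xk := implyP (fx k) mk.
    by rewrite -{1}xk permK fs.
  exists (rcons r x); rewrite all_rcons r1 /ok xG xd /= foldl_rcons r2.
  by rewrite /perm_comp mulKVg.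
move=> s r sG rG.
have fE u q : foldl perm_comp u q = perm_comp u (foldl perm_comp 1%g q).
  elim/last_ind: q => [|q x IH]; first by rewrite /perm_comp /= mul1g.
  by rewrite !foldl_rcons IH /perm_comp mulgA.
have [||q /andP[q1 /eqP q2]] := H n (r * s^-1)%g.
- by rewrite groupM ?groupV.
- by move=> k; rewrite leqNgt ltn_ord.
exists (size q); apply/existsP; exists (in_tuple q) => /=.
by rewrite q1 /= fE q2 /perm_comp mulgKV.
Qed.

End Permutations.

Section FiniteProbability.
Variables (R : realType) (T : finType).
Implicit Types (A : {set T}) (p h : T -> R).

(* A probability measure on the finite set A is given by its mass function on
   A; the values outside A are irrelevant. *)
Definition prob A p : Prop :=
  (forall x, x \in A -> 0 <= p x) /\ \sum_(x in A) p x = 1.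

Definition expect A p h : R := \sum_(x in A) p x * h x.

Definition Pr A p (E : pred T) : R := \sum_(x in A | E x) p x.

Definition uniform A p : Prop := forall x, x \in A -> p x = #|A|%:R^-1.

Definition sup_on A h : R := sup [set h x | x in [set` A]]%classic.

End FiniteProbability.

(* The set M_T: mu is the image of the product measure of the nu j, 0 < j,
   under base_map. *)
Definition product_law (R : realType) n (G : {set 'S_n})
    (t : 'I_n -> 'I_n -> 'S_n) (mu : 'S_n -> R) : Prop :=
  exists nu : 'I_n -> 'I_n -> R,
    (forall j : 'I_n, (0 < j)%N -> prob (fix_orbit G j) (nu j)) /\
    forall s, s \in G ->
      mu s = \sum_(i in family (fix_orbit G) | base_map t i == s)
               \prod_(j < n | (0 < j)%N) nu j (i j).

(* exp (- a / b) for 0 <= a, where a / 0 is +oo if 0 < a and 0 if a = 0. *)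
Definition exp_frac (R : realType) (a b : R) : R :=
  if b == 0 then (a == 0)%:R else expR (- (a / b)).

Definition sqnorm (R : realType) n (alpha : 'I_n -> 'S_n -> R) (s : 'S_n) : R :=
  \sum_k alpha k s ^+ 2.

(* Main.v *)
(* All bounds come from a Talagrand-type induction for pairs (X, f) with
   X s - f r <= sum_k alpha_k(s) [s k <> r k], in the two limiting forms
   ln E e^(X - pen) <= E f  and  E (X - pen) <= - ln E e^(-f).
   One splits a fiber of G according to the position s^-1(v) of a value v and
   moves part of the mass of each piece to the piece minimizing the right-hand
   side, along a translation th of degree at most D.  This charges alpha at the
   moved points: the position of v, which is then fixed for good, and the other
   points of the support of th.  Choosing the next special point uniformly among
   the latter, and alternating between special values and special positions by
   s |-> s^-1, one charges every point with D alpha_k^2 at most D times, so the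
   penalty D^2 |alpha|^2 / 2 suffices; here D = l for the uniform law and
   D = 2 l - 1 in the conjugation invariant case, where any ordering of the values
   gives a product representation. *)
From HB Require Import structures.
Require Import Defs.
From mathcomp Require Import all_boot all_order all_algebra all_fingroup.
From mathcomp Require Import boolp classical_sets reals topology normedtype.
From mathcomp Require Import derive realfun sequences exp.
From mathcomp Require Import ring lra zify.

Set Implicit Arguments.
Unset Strict Implicit.
Unset Printing Implicit Defensive.

Import Order.TTheory GRing.Theory Num.Theory.
Import numFieldNormedType.Exports.

Local Open Scope ring_scope.

(** * One-dimensional inequalities *)

(** A move along [th] replaces [f] by its translate and lowers [X] by the cost [Z]; the hypothesis
    linking [X] to [f] survives this, a condition on a single function would not: hence the pairs.
    The form with the penalty under the exponential gives the upper tails of (b); the other one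
    keeps only the mean of the penalty and gives the lower tails with [mu(beta^2)] and
    [mu(|alpha|^2)]. If the order of the values were fixed in advance, one point could lie in the
    support of the translation at almost every level and be charged up to [n] times. Part (b) avoids
    this by letting [th] dictate what is revealed next, which requires translations for every order
    of the values, for the law and for its image under inversion. A product law provides them only
    for the order of its base; this suffices for (a), where each nontrivial level charges [beta] as
    a whole. The bounds of (a) with [sup beta^2] come from a separate Hoeffding argument along the
    same fibers, whose 1/8 in place of 1/2 is the origin of the factor 4 in front of
    [mu(beta^2)]. *)

Lemma nonneg_deriv_ge0 (R : realType) (f df : R -> R) :
  f 0 = 0 -> (forall x : R, 0 <= x -> is_derive x 1 f (df x)) ->
  (forall x, 0 <= x -> 0 <= df x) -> forall x, 0 <= x -> 0 <= f x.
Proof.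
move=> f0 fd df0 x x0.
have [||c] := @MVT_segment R f df 0 x x0.
- by move=> y /itvP yx; apply: fd; rewrite yx.
- apply: derivable_within_continuous => y /itvP yx.
  by apply: (@ex_derive _ _ _ _ _ _ _ (fd _ _)); rewrite yx.
- move=> /itvP cx; rewrite f0 !subr0 => ->.
  by rewrite mulr_ge0 ?df0 ?cx.
Qed.

Lemma expRN_le_taylor2 (R : realType) (h : R) : 0 <= h ->
  expR (- h) <= 1 - h + h ^+ 2 / 2.
Proof.
move=> h0; rewrite -subr_ge0; move: h h0.
apply: (@nonneg_deriv_ge0 _ _ (fun h => h - 1 + expR (- h))).
- by rewrite oppr0 expR0 expr0n /=; lra.
- move=> x _.
  have c1 := is_derive1_comp (is_derive_expR (- x)) (is_deriveNid x 1).
  apply: is_derive_eq.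
  rewrite /GRing.scale /=; lra.
- by move=> x x0; have := expR_ge1Dx (- x); lra.
Qed.

Lemma ln1D_ge_taylor2 (R : realType) (h : R) : 0 <= h ->
  h - h ^+ 2 / 2 <= ln (1 + h).
Proof.
move=> h0; rewrite -subr_ge0; move: h h0.
apply: (@nonneg_deriv_ge0 _ _ (fun h => (1 + h)^-1 - 1 + h)).
- by rewrite addr0 ln1 expr0n /=; lra.
- move=> x x0.
  have x1 : 0 < 1 + x by lra.
  have c0 : is_derive x 1 (fun h : R => 1 + h) 1.
    by apply: is_derive_eq; rewrite mulr1 add0r.
  have c1 := is_derive1_comp (is_derive1_ln x1) c0.
  apply: is_derive_eq.
  rewrite /GRing.scale /=; lra.
- move=> x x0; have x1 : 0 < 1 + x by lra.
  rewrite -(pmulr_rge0 _ x1) mulrDr mulrBr divff ?gt_eqF//; nra.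
Qed.

(* With q = p e^t / (1 - p + p e^t), the function p t + t^2/8 - ln (1 - p + p e^t)
   has second derivative 1/4 - q (1 - q). *)
Lemma bernoulli_mgf_le (R : realType) (p t : R) : 0 <= p <= 1 -> 0 <= t ->
  1 - p + p * expR t <= expR (p * t + t ^+ 2 / 8).
Proof.
move=> /andP[p0 p1] t0.
pose D (x : R) := 1 - p + p * expR x.
have D1 x : 0 <= x -> 1 <= D x.
  move=> x0; have := expR_ge1Dx x; rewrite /D; nra.
have D0 x : 0 <= x -> 0 < D x by move=> /D1; lra.
have dD (x : R) : is_derive x 1 D (p * expR x).
  by apply: is_derive_eq; rewrite /GRing.scale /=; lra.
suff : 0 <= p * t + t ^+ 2 / 8 - ln (D t).
  rewrite subr_ge0 -ler_expR => /(le_trans _); apply.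
  by rewrite lnK ?posrE ?D0.
move: t t0; apply: (@nonneg_deriv_ge0 _ _ (fun x => p + x / 4 - 1 + (1 - p) * (D x)^-1)).
- by rewrite /D expR0 expr0n /= mulr1 subrK ln1; lra.
- move=> x x0.
  have c1 := is_derive1_comp (is_derive1_ln (D0 _ x0)) (dD x).
  apply: is_derive_eq; rewrite /GRing.scale /=.
  have := D0 _ x0; rewrite /D => d0; field; lra.
- apply: (@nonneg_deriv_ge0 _ _ (fun x => 1 / 4 - (1 - p) * (p * expR x) / (D x) ^+ 2)).
  + by rewrite /D expR0 mulr1 subrK invr1; lra.
  + move=> x x0.
    have c1 := is_deriveV (lt0r_neq0 (D0 _ x0)) (dD x).
    apply: is_derive_eq; rewrite /GRing.scale /=; lra.
  + move=> x x0; have d0 := D0 _ x0.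
    have d2 : 0 < D x ^+ 2 by rewrite exprn_gt0.
    rewrite subr_ge0 ler_pdivrMr// /D.
    have := sqr_ge0 (1 - p - p * expR x); lra.
Qed.

(** The minimizer of the cost is [w = min h 1], with value [h - h^2/2] or [1/2]. The first bound
    feeds the case [b = true] of the induction, the second the case [b = false]. *)
Lemma cost_min_expR (R : realType) (h : R) : 0 <= h ->
  exists w, [/\ 0 <= w <= 1, expR ((1 - w) * h + w ^+ 2 / 2) <= 1 + h &
    expR (- h) <= 1 - ((1 - w) * h + w ^+ 2 / 2)].
Proof.
move=> h0; have [h1|h1] := leP h 1.
  exists h; split; first by rewrite h0.
    have h2 : 0 < 1 + h by lra.
    rewrite -[leRHS](@lnK R) ?posrE// ler_expR.
    by have := ln1D_ge_taylor2 h0; lra.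
  by have := expRN_le_taylor2 h0; lra.
(* Here the cost is 1/2: [e^(1/2) <= 2] follows from [e^(-1/2) >= 1/2], and
   [e^(-h) <= e^(-1) <= 1/2]. *)
exists 1; have e1 := expR_ge1Dx (1 : R); split; first by rewrite ler01 lexx.
  have := @expRN_le_taylor2 R (1 / 2) ltac:(lra).
  have e := expRxMexpNx_1 (1 / 2 : R); have := expR_gt0 (1 / 2 : R).
  have := expR_ge1Dx (- (1 / 2) : R).
  rewrite expr1n subrr mul0r add0r; nra.
have : expR (- h) <= expR (- 1) by rewrite ler_expR; lra.
have := @expRN_le_taylor2 R 1 ltac:(lra).
by rewrite expr1n subrr mul0r add0r; lra.
Qed.

(** * Conditional expectations and the functionals Lam and Psi *)

Section ConditionalFunctionals.
Variables (R : realType) (T : finType).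
Implicit Types (A : {set T}) (mu h f X : T -> R) (b : bool).

Definition mass A mu : R := \sum_(s in A) mu s.

(** The normalization lets a fiber carry the plain restriction of [mu]. On a set of mass 0 the value
    is 0, whence the positivity hypotheses below. *)
Definition cexp A mu h : R := expect A mu h / mass A mu.

(* The two families of functionals are the limits a -> 1 and a -> 0 of
   X |-> ln (E e^(a X)) / a and f |-> - ln (E e^(-(1-a) f)) / (1-a). *)
Definition Lam b A mu X : R :=
  if b then ln (cexp A mu (fun s => expR (X s))) else cexp A mu X.

Definition Psi b A mu f : R :=
  if b then cexp A mu f else - ln (cexp A mu (fun s => expR (- f s))).

Lemma eq_cexp A mu h1 h2 : {in A, h1 =1 h2} -> cexp A mu h1 = cexp A mu h2.
Proof.
move=> e; congr (_ / _); apply: eq_bigr => s sA; by rewrite e.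
Qed.

Lemma cexpD A mu h1 h2 :
  cexp A mu (fun s => h1 s + h2 s) = cexp A mu h1 + cexp A mu h2.
Proof.
rewrite /cexp -mulrDl /expect -big_split /=.
by congr (_ / _); apply: eq_bigr => s _; rewrite mulrDr.
Qed.

Lemma cexpZ A mu (k : R) h : cexp A mu (fun s => k * h s) = k * cexp A mu h.
Proof.
rewrite /cexp mulrA /expect mulr_sumr.
by congr (_ / _); apply: eq_bigr => s _; rewrite mulrCA.
Qed.

Lemma cexp_sum (I : finType) A mu (H : I -> T -> R) :
  cexp A mu (fun s => \sum_i H i s) = \sum_i cexp A mu (H i).
Proof.
rewrite /cexp -mulr_suml /expect exchange_big /=.
by congr (_ / _); apply: eq_bigr => s _; rewrite mulr_sumr.
Qed.

Lemma mass_ge0 A mu : {in A, forall s, 0 <= mu s} -> 0 <= mass A mu.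
Proof. by move=> mu0; apply: sumr_ge0. Qed.

Lemma mass_gt0_exists A mu : 0 < mass A mu -> exists s, s \in A.
Proof.
have [->|[s sA] _] := set_0Vmem A; last by exists s.
by rewrite /mass big_set0 ltxx.
Qed.

Lemma expect_cexp A mu h : {in A, forall s, 0 <= mu s} ->
  expect A mu h = mass A mu * cexp A mu h.
Proof.
move=> mu0; rewrite /cexp mulrCA.
have [m0|m0] := eqVneq (mass A mu) 0; last by rewrite divff// mulr1.
rewrite m0 mul0r mulr0 /expect big1// => s sA.
move/eqP: m0; rewrite psumr_eq0// => /allP /(_ s).
by rewrite mem_index_enum sA => /(_ isT) /eqP ->; rewrite mul0r.
Qed.

Section Positive.
Variables (A : {set T}) (mu : T -> R).
Hypothesis mu0 : {in A, forall s, 0 <= mu s}.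
Hypothesis mA : 0 < mass A mu.

Lemma cexp_cst (k : R) : cexp A mu (fun=> k) = k.
Proof. by rewrite /cexp /expect -mulr_suml mulrAC divff ?mul1r ?gt_eqF. Qed.

Lemma cexp_le h1 h2 : {in A, forall s, h1 s <= h2 s} ->
  cexp A mu h1 <= cexp A mu h2.
Proof.
move=> le12; rewrite ler_pM2r ?invr_gt0//.
by apply: ler_sum => s sA; rewrite ler_wpM2l ?mu0 ?le12.
Qed.

Lemma cexp_gt0 h : {in A, forall s, 0 < h s} -> 0 < cexp A mu h.
Proof.
move=> h0; rewrite divr_gt0//.
have [s sA mus] : exists2 s, s \in A & 0 < mu s.
  apply/exists_inP; apply: contraLR mA; rewrite negb_exists_in -leNgt => /forall_inP na.
  by apply: sumr_le0 => s /na; rewrite -leNgt.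
rewrite /expect (bigD1 s)//= ltr_wpDr ?mulr_gt0 ?h0//.
by apply: sumr_ge0 => r /andP[rA _]; rewrite mulr_ge0 ?mu0// ltW ?h0.
Qed.

(** In this form a bound on the logarithmic functional becomes a bound on an expectation, which can
    be averaged. *)
Lemma Lam_leP b X (c : R) :
  (Lam b A mu X <= c) =
  (if b then cexp A mu (fun s => expR (X s - c)) <= 1 else cexp A mu X <= c).
Proof.
case: b => //=; have e0 : 0 < cexp A mu (fun s => expR (X s)).
  by apply: cexp_gt0 => s _; exact: expR_gt0.
rewrite -ler_expR lnK ?posrE//.
rewrite [in RHS](@eq_cexp _ _ _ (fun s => (expR c)^-1 * expR (X s))).
  by rewrite cexpZ ler_pdivrMl ?expR_gt0 ?mulr1.
by move=> s _; rewrite expRB mulrC.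
Qed.

Lemma Lam_le b X Y : {in A, forall s, X s <= Y s} ->
  Lam b A mu X <= Lam b A mu Y.
Proof.
case: b => le /=; last exact: cexp_le.
rewrite ler_ln ?posrE ?cexp_gt0// => [|s _|s _]; rewrite ?expR_gt0//.
by apply: cexp_le => s sA; rewrite ler_expR le.
Qed.

Lemma Lam_cst b (c : R) : Lam b A mu (fun=> c) = c.
Proof. by case: b; rewrite /= cexp_cst ?expRK. Qed.

Lemma Psi_ge b f (c : R) : {in A, forall s, c <= f s} -> c <= Psi b A mu f.
Proof.
case: b => le /=; first by rewrite -{1}(cexp_cst c) cexp_le.
rewrite lerNr -[leRHS]expRK -[in leRHS](cexp_cst (expR (- c))).
rewrite ler_ln ?posrE ?cexp_gt0// => [|s _|s _]; rewrite ?expR_gt0//.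
by apply: cexp_le => s sA; rewrite ler_expR lerN2 le.
Qed.

(** Convexity of the functional; for [b = true] this is the Hoelder inequality, reduced to Jensen by
    subtracting [c i] from [Y i]. *)
Lemma Lam_mix b (I : finType) (p : I -> R) (Y : I -> T -> R) (c : I -> R) :
  (forall i, 0 <= p i) -> \sum_i p i = 1 ->
  (forall i, p i != 0 -> Lam b A mu (Y i) <= c i) ->
  Lam b A mu (fun s => \sum_i p i * Y i s) <= \sum_i p i * c i.
Proof.
move=> p0 p1 le; rewrite Lam_leP; case: b le => le; last first.
  rewrite cexp_sum; apply: ler_sum => i _; rewrite cexpZ.
  have [->|pi] := eqVneq (p i) 0; first by rewrite !mul0r.
  by rewrite ler_wpM2l//; exact: le.
apply: (@le_trans _ _ (cexp A mu (fun s => \sum_i p i * expR (Y i s - c i)))).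
  apply: cexp_le => s _; rewrite -sumrB.
  set z := \sum_i _; have ez := expR_gt0 z.
  (* Jensen: [e^z] is the average of the values at [Y i s - c i] of the tangent line of exp at
     [z]. *)
  have -> : expR z = \sum_i p i * (expR z * (1 + (Y i s - c i) - z)).
    rewrite (eq_bigr (fun i => expR z * (p i * (1 - z) + (p i * Y i s - p i * c i)))).
      by rewrite -mulr_sumr big_split /= -mulr_suml p1 -/z mul1r subrK mulr1.
    by move=> i _; ring.
  apply: ler_sum => i _; rewrite ler_wpM2l//.
  rewrite -[in leRHS](subrKC z (Y i s - c i)) expRD ler_wpM2l ?expR_ge0//.
  by have := expR_ge1Dx (Y i s - c i - z); lra.
rewrite cexp_sum -p1; apply: ler_sum => i _; rewrite cexpZ.
have [->|pi] := eqVneq (p i) 0; first by rewrite !mul0r.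
by rewrite ler_piMr//; have := le i pi; rewrite Lam_leP.
Qed.

Lemma Lam_mix2 b (w : R) Y0 Y1 (c0 c1 : R) : 0 <= w <= 1 ->
  Lam b A mu Y0 <= c0 -> Lam b A mu Y1 <= c1 ->
  Lam b A mu (fun s => (1 - w) * Y0 s + w * Y1 s) <= (1 - w) * c0 + w * c1.
Proof.
move=> /andP[w0 w1] le0 le1.
have := @Lam_mix b bool (fun i => if i then 1 - w else w)
  (fun i => if i then Y0 else Y1) (fun i => if i then c0 else c1).
rewrite !big_bool /=; set L := (X in Lam b A mu X).
have -> : L = (fun s => (1 - w) * Y0 s + w * Y1 s).
  by apply: funext => s; rewrite /L big_bool.
by apply=> //; [case; lra | lra | case].
Qed.

Lemma LamD b X (c : R) : Lam b A mu (fun s => X s + c) = Lam b A mu X + c.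
Proof.
case: b => /=; last by rewrite cexpD cexp_cst.
rewrite (@eq_cexp _ _ _ (fun s => expR c * expR (X s))).
  rewrite cexpZ lnM ?posrE ?expR_gt0// ?expRK 1?addrC//.
  by apply: cexp_gt0 => s _; exact: expR_gt0.
by move=> s _; rewrite expRD mulrC.
Qed.

End Positive.

(** * Decomposition of a law according to a label *)

Section Labels.
Variables (I : finType) (lab : T -> I) (A : {set T}) (mu : T -> R).
Hypothesis mu0 : {in A, forall s, 0 <= mu s}.
Hypothesis mA : 0 < mass A mu.

Definition piece x : {set T} := [set s in A | lab s == x]%SET.

Lemma piece_ge0 x : {in piece x, forall s, 0 <= mu s}.
Proof. by move=> s; rewrite inE => /andP[/mu0]. Qed.

Definition pweight x : R := mass (piece x) mu / mass A mu.

Lemma pweight_ge0 x : 0 <= pweight x.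
Proof. by rewrite divr_ge0 ?(ltW mA)// mass_ge0//; exact: piece_ge0. Qed.

Lemma pweight_gt0 x : (pweight x != 0) = (0 < mass (piece x) mu).
Proof.
rewrite mulf_eq0 invr_eq0 (gt_eqF mA) orbF lt0r mass_ge0 ?andbT//.
exact: piece_ge0.
Qed.

Lemma sum_pweight : \sum_x pweight x = 1.
Proof.
rewrite -mulr_suml -[RHS](@divff _ (mass A mu)) ?gt_eqF//; congr (_ / _).
rewrite [RHS](partition_big lab xpredT)//=.
by apply: eq_bigr => x _; apply: eq_bigl => s; rewrite inE.
Qed.

Lemma cexp_piece h : cexp A mu h = \sum_x pweight x * cexp (piece x) mu h.
Proof.
rewrite {1}/cexp /expect (partition_big lab xpredT)//= mulr_suml.
apply: eq_bigr => x _; rewrite mulrAC -expect_cexp; last exact: piece_ge0.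
by congr (_ / _); apply: eq_bigl => s; rewrite inE.
Qed.

Lemma cexp_piece_le h (F : I -> R) :
  (forall x, 0 < mass (piece x) mu -> cexp (piece x) mu h <= F x) ->
  cexp A mu h <= \sum_x pweight x * F x.
Proof.
move=> le; rewrite cexp_piece; apply: ler_sum => x _.
have [->|] := eqVneq (pweight x) 0; first by rewrite !mul0r.
by rewrite pweight_gt0 => px; rewrite ler_wpM2l ?pweight_ge0 ?le.
Qed.

Lemma exists_piece_gt0 : exists x, 0 < mass (piece x) mu.
Proof.
apply/existsP; have := oner_neq0 R; apply: contraNT.
rewrite negb_exists -sum_pweight => /forallP na; rewrite big1// => x _.
by apply/eqP; rewrite -[_ == _]negbK pweight_gt0 na.
Qed.

Lemma sum_pweightD (k : R) (E : I -> R) :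
  \sum_x pweight x * (k + E x) = k + \sum_x pweight x * E x.
Proof.
under eq_bigr do rewrite mulrDr.
by rewrite big_split /= -mulr_suml sum_pweight mul1r.
Qed.

(* The mass of each piece is partly moved to the piece on which Psi is minimal. *)
Lemma Lam_le_Psi_piece b X f :
  (forall x y (w : R), 0 < mass (piece x) mu -> 0 < mass (piece y) mu -> 0 <= w <= 1 ->
     Lam b (piece x) mu X <=
       (1 - w) * Psi b (piece x) mu f + w * Psi b (piece y) mu f + w ^+ 2 / 2) ->
  Lam b A mu X <= Psi b A mu f.
Proof.
move=> le; have [x0 px0] := exists_piece_gt0.
pose F x := Psi b (piece x) mu f.
case: (@arg_minP _ _ _ x0 (fun x => 0 < mass (piece x) mu) F px0) => y py miny.
(* [G] is the minimal cost for the gap [F x - F y]. The two bounds are chosen so that averaging over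
   the pieces reproduces the mean of [f], respectively of [e^(-f)]; one use of [1 + z <= e^z] or
   [ln z <= z - 1] then concludes. *)
have bound x : 0 < mass (piece x) mu -> exists G : R,
    [/\ Lam b (piece x) mu X <= F y + G, expR G <= 1 + (F x - F y) &
        expR (- (F x - F y)) <= 1 - G].
  move=> px; have : 0 <= F x - F y by rewrite subr_ge0 miny.
  move=> /cost_min_expR[w [w01 e1 e2]].
  eexists; split; [|exact: e1|exact: e2].
  by apply: le_trans (le x y w px py w01) _; rewrite /F; lra.
case: b le @F y py miny bound => le F y py miny bound.
  have e0 : 0 < cexp A mu (fun s => expR (X s)).
    by apply: cexp_gt0 => // s _; exact: expR_gt0.
  rewrite /= -ler_expR lnK ?posrE//.
  apply: (@le_trans _ _ (\sum_x pweight x * (expR (F y) * (1 + (F x - F y))))).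
    apply: cexp_piece_le => x px; have [G [XG e1 _]] := bound x px.
    move: XG; rewrite -ler_expR /Lam lnK ?posrE => [/le_trans|]; last first.
      by apply: cexp_gt0 => // [|s _]; [exact: piece_ge0|exact: expR_gt0].
    by apply; rewrite expRD ler_wpM2l ?expR_ge0.
  under eq_bigr do rewrite mulrCA (addrC (F _)) addrA.
  rewrite -mulr_sumr sum_pweightD.
  have -> : \sum_x pweight x * F x = cexp A mu f by rewrite (cexp_piece f).
  rewrite -[in leRHS](subrK (F y) (cexp A mu f)) expRD mulrC ler_wpM2r ?expR_ge0//.
  by have := expR_ge1Dx (cexp A mu f - F y); lra.
set z := cexp A mu (fun s => expR (- f s)).
have z0 : 0 < z by apply: cexp_gt0 => // s _; exact: expR_gt0.
apply: (@le_trans _ _ (\sum_x pweight x *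
    (F y + 1 + - expR (F y) * cexp (piece x) mu (fun s => expR (- f s))))).
  apply: cexp_piece_le => x px; have [G [XG _]] := bound x px.
  move: XG => /le_trans + eG; apply; move: eG; rewrite opprB expRB -/F.
  rewrite -(expRN (F x)) {2}/F /= opprK lnK ?posrE; first by lra.
  by apply: cexp_gt0 => // [|s _]; [exact: piece_ge0|exact: expR_gt0].
rewrite sum_pweightD; under eq_bigr do rewrite mulrCA.
rewrite -mulr_sumr -cexp_piece -/z /=.
have : 0 < expR (F y) * z by rewrite mulr_gt0 ?expR_gt0.
move=> p0; have := @le_ln1Dx _ (expR (F y) * z - 1) ltac:(lra).
rewrite addrCA subrr addr0 lnM ?posrE ?expR_gt0// expRK; lra.
Qed.

(* The chord bound for exp on an interval of length h reduces to a two-point law. *)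
Lemma cexp_expR_piece_le X (F : I -> R) (k h : R) : 0 <= h ->
  (forall x, 0 < mass (piece x) mu ->
     cexp (piece x) mu (fun s => expR (X s)) <= expR (F x + k)) ->
  (forall x y, 0 < mass (piece x) mu -> 0 < mass (piece y) mu -> F x - F y <= h) ->
  cexp A mu (fun s => expR (X s)) <=
    expR (\sum_x pweight x * F x + k + h ^+ 2 / 8).
Proof.
move=> h0 le osc; have [x0 px0] := exists_piece_gt0.
case: (@arg_minP _ _ _ x0 (fun x => 0 < mass (piece x) mu) F px0) => y py miny.
(* For [h = 0] the quotient is 0, which is right because all [F x] then coincide. *)
pose u x := (F x - F y) / h.
have uP x : 0 < mass (piece x) mu -> 0 <= u x <= 1 /\ F x = F y + u x * h.
  move=> px; have := miny x px; have := osc x y px py; rewrite /u.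
  have [->|hn0] := eqVneq h 0; first by rewrite invr0 mulr0 ler01 lexx; split=> //; lra.
  have hp : 0 < h by rewrite lt0r hn0.
  move=> a1 a2; rewrite divr_ge0 ?subr_ge0// ler_pdivrMr// mul1r a1; split=> //.
  by rewrite divfK// addrCA subrr addr0.
pose p := \sum_x pweight x * u x.
have uw x : pweight x * F x = pweight x * (F y + u x * h).
  have [->|] := eqVneq (pweight x) 0; first by rewrite !mul0r.
  by rewrite pweight_gt0 => /uP[_ ->].
have p01 : 0 <= p <= 1.
  rewrite /p -[X in _ <= _ <= X]sum_pweight; apply/andP; split.
    apply: sumr_ge0 => x _.
    have [->|] := eqVneq (pweight x) 0; first by rewrite !mul0r.
    by rewrite pweight_gt0 => /uP[/andP[ux _] _]; rewrite mulr_ge0 ?pweight_ge0.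
  apply: ler_sum => x _; have [->|] := eqVneq (pweight x) 0; first by rewrite !mul0r.
  by rewrite pweight_gt0 => /uP[/andP[_ ux] _]; rewrite ler_piMr ?pweight_ge0.
have -> : \sum_x pweight x * F x = F y + p * h.
  rewrite (eq_bigr _ (fun x _ => uw x)) sum_pweightD /p mulr_suml.
  by congr (_ + _); apply: eq_bigr => x _; rewrite mulrA.
apply: (@le_trans _ _ (\sum_x pweight x *
    (expR (F y + k) * (1 + u x * (expR h - 1))))).
  apply: cexp_piece_le => x px; apply: le_trans (le x px) _.
  have [/andP[u0 u1] ->] := uP x px.
  have -> : F y + u x * h + k = F y + k + u x * h by ring.
  rewrite expRD ler_wpM2l ?expR_ge0//.
  (* The chord bound combines the tangent inequalities at [u x * h], evaluated at [h] and at 0, with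
     weights [u x] and [1 - u x]. *)
  have e0 := expR_gt0 (u x * h).
  have e1 := expR_ge1Dx (h - u x * h).
  rewrite -(ler_pM2l e0) -expRD subrKC in e1.
  have e2 := expR_ge1Dx (- (u x * h)).
  rewrite -(ler_pM2l e0) -expRD subrr expR0 in e2.
  nra.
under eq_bigr do rewrite mulrCA.
rewrite -mulr_sumr sum_pweightD.
have -> : F y + p * h + k + h ^+ 2 / 8 = F y + k + (p * h + h ^+ 2 / 8) by ring.
rewrite (expRD (F y + k)) ler_wpM2l ?expR_ge0//; apply: le_trans (bernoulli_mgf_le p01 h0).
under eq_bigr do rewrite mulrA.
by rewrite -mulr_suml -/p; lra.
Qed.

End Labels.
End ConditionalFunctionals.

(** * Fibers of a permutation group *)

Section Fibers.
Variables (R : realType) (n : nat) (G : {group 'S_n}).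
Implicit Types (s r th : 'S_n) (v w : 'I_n) (W : {set 'I_n}) (mu f X : 'S_n -> R).

(** For [s0] in [G] this is a coset of the pointwise stabilizer of [W]. Positions of values are
    recorded because a product over a base determines them from the last digit downwards. *)
Definition fiber W s0 : {set 'S_n} :=
  [set s in G | [forall w in W, (s^-1)%g w == (s0^-1)%g w]]%SET.

Lemma fiberP W s0 s :
  reflect (s \in G /\ forall w, w \in W -> (s^-1)%g w = (s0^-1)%g w)
          (s \in fiber W s0).
Proof.
rewrite inE; apply: (iffP andP) => -[sG]; first by move=> /eqfun_inP h.
by move=> h; split=> //; apply/eqfun_inP.
Qed.

Lemma fiberG W s0 : {subset fiber W s0 <= G}.
Proof. by move=> s /fiberP[]. Qed.

Lemma fiber_set0 s0 : fiber finset.set0 s0 = G.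
Proof. by apply/setP => s; apply/fiberP/idP => [[]|sG] //; split=> // w; rewrite inE. Qed.

Lemma fiber_setU1 W v s0 s1 : s1 \in fiber W s0 ->
  piece (fun s => (s^-1)%g v) (fiber W s0) ((s1^-1)%g v) = fiber (v |: W)%SET s1.
Proof.
move=> /fiberP[s1G e1]; apply/setP => s; rewrite inE; apply/andP/fiberP.
  move=> [/fiberP[sG e] /eqP ev]; split=> // w /setU1P[->//|wW].
  by rewrite e// e1.
move=> [sG e]; split; last by rewrite e ?setU11.
by apply/fiberP; split=> // w wW; rewrite e ?e1// inE wW orbT.
Qed.

Lemma fiber_setT s0 s : s \in fiber [set: 'I_n] s0 -> s = s0.
Proof.
by move=> /fiberP[_ e]; apply: invg_inj; apply/permP => w; apply: e; rewrite inE.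
Qed.

(* For th as below, s |-> th * s maps the fiber of s1 onto that of s2 and carries
   the conditional law of mu on the one to that on the other. *)
Definition translation mu W s1 s2 th : Prop :=
  [/\ th \in G, forall w, w \in W -> th ((s2^-1)%g w) = (s1^-1)%g w &
      forall s, s \in fiber W s1 ->
        mu (th * s)%g * mass (fiber W s1) mu = mu s * mass (fiber W s2) mu].

(** [D] is what is known about the price of a move: a bound on its degree, or its factorization into
    few elements of small degree. *)
Definition translatable (D : 'S_n -> Prop) mu W v : Prop :=
  forall s1 s2, s1 \in G -> s2 \in fiber W s1 ->
    0 < mass (fiber (v |: W)%SET s1) mu -> 0 < mass (fiber (v |: W)%SET s2) mu ->
    exists2 th, translation mu (v |: W)%SET s1 s2 th & D th.

Lemma translation_fiber W s1 s2 th s :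
  th \in G -> (forall w, w \in W -> th ((s2^-1)%g w) = (s1^-1)%g w) ->
  ((th * s)%g \in fiber W s2) = (s \in fiber W s1).
Proof.
move=> thG e; apply/fiberP/fiberP => -[sG es].
  split; first by rewrite -(groupMl _ thG).
  by move=> w wW; rewrite -e// -es// invMg permM permKV.
split; first by rewrite groupM.
by move=> w wW; rewrite invMg permM es// -e// permK.
Qed.

Lemma sum_translation W s1 s2 th (F : 'S_n -> R) :
  th \in G -> (forall w, w \in W -> th ((s2^-1)%g w) = (s1^-1)%g w) ->
  \sum_(s in fiber W s2) F s = \sum_(s in fiber W s1) F (th * s)%g.
Proof.
move=> thG e; rewrite (reindex_inj (mulgI th)) /=.
by apply: eq_bigl => s; rewrite (translation_fiber _ thG e).
Qed.

Lemma cexp_translation mu W s1 s2 th h :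
  0 < mass (fiber W s1) mu -> 0 < mass (fiber W s2) mu ->
  translation mu W s1 s2 th ->
  cexp (fiber W s2) mu h = cexp (fiber W s1) mu (fun s => h (th * s)%g).
Proof.
move=> m1 m2 [thG e emu]; rewrite /cexp /expect (sum_translation _ thG e).
apply/eqP; rewrite eqr_div ?(gt_eqF m1) ?(gt_eqF m2)// !mulr_suml.
apply/eqP; apply: eq_bigr => s sF.
by rewrite mulrAC emu// mulrAC.
Qed.

Lemma Psi_translation b mu W s1 s2 th f :
  0 < mass (fiber W s1) mu -> 0 < mass (fiber W s2) mu ->
  translation mu W s1 s2 th ->
  Psi b (fiber W s2) mu f = Psi b (fiber W s1) mu (fun s => f (th * s)%g).
Proof. by move=> m1 m2 tr; case: b; rewrite /= (cexp_translation _ m1 m2 tr). Qed.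

Section Recursion.
Variable mu : 'S_n -> R.
Hypothesis mu0 : {in G, forall s, 0 <= mu s}.

Lemma fiber_ge0 W s0 : {in fiber W s0, forall s, 0 <= mu s}.
Proof. by move=> s /fiberG/mu0. Qed.

(* Z is the cost of moving along th; the move is made with probability w. *)
Lemma Lam_translation_le b W s1 s2 th X f pen pen_in Z (w : R) :
  0 < mass (fiber W s1) mu -> 0 < mass (fiber W s2) mu ->
  translation mu W s1 s2 th ->
  Lam b (fiber W s1) mu (fun s => X s - pen_in s) <= Psi b (fiber W s1) mu f ->
  Lam b (fiber W s1) mu (fun s => X s - Z s - pen_in s)
    <= Psi b (fiber W s1) mu (fun s => f (th * s)%g) ->
  {in fiber W s1, forall s, Z s ^+ 2 <= 2 * (pen s - pen_in s)} ->
  0 <= w <= 1 ->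
  Lam b (fiber W s1) mu (fun s => X s - pen s) <=
    (1 - w) * Psi b (fiber W s1) mu f + w * Psi b (fiber W s2) mu f + w ^+ 2 / 2.
Proof.
move=> m1 m2 tr le0 le1 Zle w01; rewrite (Psi_translation _ _ m1 m2 tr).
have := Lam_mix2 (@fiber_ge0 W s1) m1 w01 le0 le1.
rewrite -(lerD2r (w ^+ 2 / 2)) -(LamD (@fiber_ge0 W s1) m1) => /(le_trans _); apply.
(* Only [w Z] is paid, and [w Z <= w^2/2 + Z^2/2]: the first term is the price of mixing, the second
   is covered by the growth of the penalty. *)
apply: (Lam_le (@fiber_ge0 W s1) m1) => s sF; have := Zle s sF; have := sqr_ge0 (w - Z s).
move/andP: w01 => [w0 w1]; lra.
Qed.

Definition from (j : nat) : {set 'I_n} := [set w : 'I_n | (j <= w)%N]%SET.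

Lemma from_setU1 v : (v |: from v.+1)%SET = from v.
Proof. by apply/setP => w; rewrite !inE [RHS]leq_eqVlt [in RHS]eq_sym. Qed.

Definition Kbelow (j : nat) : nat :=
  #|[set v : 'I_n | [&& (v < j)%N, (0 < v)%N & fix_orbit G v != [set v]%SET]]%SET|.

(** Two elements with the same positions of the values above [v] differ by an element of
    [fix_above G v], so a trivial orbit forces the position of [v]. Such levels cost nothing, which
    is why [K_] appears instead of [n]. *)
Lemma fiber_trivial_orbit v s0 : fix_orbit G v = [set v]%SET -> s0 \in G ->
  fiber (from v.+1) s0 = fiber (from v) s0.
Proof.
move=> Ov s0G; apply/setP => s; apply/fiberP/fiberP => -[sG es]; split=> // w.
  rewrite inE leq_eqVlt => /orP[/eqP vw|vw]; last by apply: es; rewrite inE.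
  have {w vw}-> : w = v by exact/esym/val_inj.
  have : (s^-1 * s0)%g v \in fix_orbit G v.
    apply/imsetP; exists (s^-1 * s0)%g => //; rewrite inE groupM ?groupV//=.
    apply/forallP => k; apply/implyP => vk.
    by rewrite permM es ?inE// permKV.
  by rewrite Ov inE permM => /eqP {2}<-; rewrite permK.
by rewrite inE => vw; apply: es; rewrite inE ltnW.
Qed.

Lemma KbelowS v : Kbelow v.+1 =
  (((0 < v)%N && (fix_orbit G v != [set v]%SET)) + Kbelow v)%N.
Proof.
rewrite /Kbelow (cardsD1 v) inE leqnn /=; congr (_ + _)%N.
apply: eq_card => w; rewrite !inE ltnS leq_eqVlt -(inj_eq val_inj).
by case: ltngtP.
Qed.

(** * Revealing the positions of the values from the top down *)

Section Chain.
Variables (D : 'S_n -> Prop) (d : 'S_n -> 'S_n -> nat) (c : nat).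
Hypothesis tr : forall v, translatable D mu (from v.+1) v.
Hypothesis d_refl : forall s, s \in G -> d s s = 0%N.
Hypothesis d_move : forall s r th, s \in G -> r \in G -> th \in G -> D th ->
  (d s (th * r)%g <= d s r + c)%N.

(** A move raises [d s r] by at most [c], so [X - c beta] and the translate of [f] satisfy the
    hypothesis again. Since [beta] is read at [s] only, every nontrivial level adds the same
    [c^2 beta(s)^2 / 2]. *)
Lemma Lam_chain b j s0 (beta X f : 'S_n -> R) : (j <= n)%N -> s0 \in G ->
  {in G, forall s, 0 <= beta s} -> 0 < mass (fiber (from j) s0) mu ->
  {in fiber (from j) s0 &, forall s r, X s - f r <= beta s * (d s r)%:R} ->
  Lam b (fiber (from j) s0) mu
      (fun s => X s - (Kbelow j)%:R * c%:R ^+ 2 * beta s ^+ 2 / 2)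
    <= Psi b (fiber (from j) s0) mu f.
Proof.
move=> + + b0; elim: j s0 X f => [|j IH] s0 X f jn s0G m0 Xf.
  have e0 s : s \in fiber (from 0) s0 -> s = s0.
    have -> : from 0 = [set: 'I_n] by apply/setP => w; rewrite !inE.
    exact: fiber_setT.
  have s0F : s0 \in fiber (from 0) s0 by apply/fiberP.
  apply: (@le_trans _ _ (X s0)).
    rewrite -[leRHS](Lam_cst m0 b); apply: (Lam_le (@fiber_ge0 _ s0) m0) => s /e0 ->.
    have -> : Kbelow 0 = 0%N by apply/eqP; rewrite cards_eq0; apply/eqP/setP => w; rewrite !inE.
    lra.
  apply: (Psi_ge (@fiber_ge0 _ s0) m0) => s /e0 ->; have := Xf _ _ s0F s0F.
  by rewrite d_refl// mulr0 subr_le0.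
pose v := Ordinal jn.
have [/eqP Ov|Ov] := boolP (fix_orbit G v == [set v]%SET).
  have eF := fiber_trivial_orbit Ov s0G.
  have -> : Kbelow j.+1 = Kbelow j by rewrite (KbelowS v) Ov eqxx andbF.
  by rewrite eF in m0 Xf *; apply: IH => //; exact: ltnW.
have v0 : (0 < v)%N by rewrite lt0n; apply: contraNN Ov => /eqP /fix_orbit0 ->.
have -> : (Kbelow j.+1)%:R = 1 + (Kbelow j)%:R :> R by rewrite (KbelowS v) Ov v0 natrD.
apply: (@Lam_le_Psi_piece _ _ _ (fun s => (s^-1)%g v) _ _ (@fiber_ge0 _ s0) m0) => x y w px py w01.
have [s1] := mass_gt0_exists px; rewrite inE => /andP[s1F /eqP ex].
have [s2] := mass_gt0_exists py; rewrite inE => /andP[s2F /eqP ey].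
have s1G := fiberG s1F; have s2G := fiberG s2F.
move: px py; rewrite -ex -ey !fiber_setU1// => px py.
pose pin s := (Kbelow j)%:R * c%:R ^+ 2 * beta s ^+ 2 / 2.
have sub s : s \in fiber (from v) s1 -> s \in fiber (from v.+1) s0.
  by rewrite -from_setU1 -(fiber_setU1 _ s1F) inE => /andP[].
have inner X' f' : {in fiber (from v) s1 &, forall s r, X' s - f' r <= beta s * (d s r)%:R} ->
    Lam b (fiber (from v) s1) mu (fun s => X' s - pin s) <= Psi b (fiber (from v) s1) mu f'.
  by move=> Xf'; apply: IH => //; [exact: ltnW|rewrite from_setU1 in px].
have s21 : s2 \in fiber (from v.+1) s1.
  apply/fiberP; split=> // w' w'v.
  by rewrite (fiberP _ _ _ s1F).2// (fiberP _ _ _ s2F).2.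
have [th tth Dth] := tr s1G s21 px py.
have [thG eth _] := tth.
rewrite from_setU1 in px py tth eth *.
apply: (Lam_translation_le (pen_in := pin) (Z := fun s => c%:R * beta s) px py tth) => //.
- by apply: inner => s r /sub sF /sub rF; exact: Xf.
- apply: inner => s r /[dup] /sub sF /fiberG sG /[dup] /sub rF rF1.
  have rG := fiberG rF1.
  have thr : (th * r)%g \in fiber (from v.+1) s0.
    have : (th * r)%g \in fiber (from v) s2 by rewrite (translation_fiber _ thG eth).
    by rewrite -from_setU1 -(fiber_setU1 _ s2F) inE => /andP[].
  have := Xf _ _ sF thr; have := b0 s sG.
  have := d_move sG rG thG Dth; rewrite -(ler_nat R) natrD => dd bs.
  have := ler_wpM2l bs dd; lra.
- by move=> s _; rewrite /pin; lra.
Qed.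

(** Azuma-Hoeffding: a translation pairs [s] with [th * s], at distance at most [c], so the means of
    [X] on two pieces differ by at most [c L], and a nontrivial level adds [(c L)^2 / 8]. *)
Lemma cexp_chain_lipschitz j s0 (L : R) X : (j <= n)%N -> s0 \in G ->
  0 < mass (fiber (from j) s0) mu -> 0 <= L ->
  {in G &, forall s r, X s - X r <= L * (d s r)%:R} ->
  cexp (fiber (from j) s0) mu (fun s => expR (X s)) <=
    expR (cexp (fiber (from j) s0) mu X + (Kbelow j)%:R * ((c%:R * L) ^+ 2 / 8)).
Proof.
move=> + + + L0 XL; elim: j s0 => [|j IH] s0 jn s0G m0.
  have e0 s : s \in fiber (from 0) s0 -> s = s0.
    have -> : from 0 = [set: 'I_n] by apply/setP => w; rewrite !inE.
    exact: fiber_setT.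
  have eX (h : 'S_n -> R) : cexp (fiber (from 0) s0) mu h = h s0.
    by rewrite -[RHS](cexp_cst m0); apply: eq_cexp => s /e0 ->.
  rewrite !eX ler_expR lerDl mulr_ge0 ?ler0n//; have := sqr_ge0 (c%:R * L); lra.
pose v := Ordinal jn.
have [/eqP Ov|Ov] := boolP (fix_orbit G v == [set v]%SET).
  have eF := fiber_trivial_orbit Ov s0G.
  have -> : Kbelow j.+1 = Kbelow j by rewrite (KbelowS v) Ov eqxx andbF.
  by rewrite eF in m0 *; apply: IH => //; exact: ltnW.
have v0 : (0 < v)%N by rewrite lt0n; apply: contraNN Ov => /eqP /fix_orbit0 ->.
have -> : (Kbelow j.+1)%:R = 1 + (Kbelow j)%:R :> R by rewrite (KbelowS v) Ov v0 natrD.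
rewrite (cexp_piece (fun s => (s^-1)%g v) (@fiber_ge0 _ s0) X).
rewrite mulrDl mul1r (addrC (_ / 8)) addrA.
apply: (cexp_expR_piece_le (@fiber_ge0 _ s0)) => // [|x px|x y px py]; first by rewrite mulr_ge0.
  have [s1] := mass_gt0_exists px; rewrite inE => /andP[s1F /eqP ex].
  move: px; rewrite -ex fiber_setU1// from_setU1 => px.
  by apply: IH => //; [exact: ltnW|exact: fiberG s1F].
have [s1] := mass_gt0_exists px; rewrite inE => /andP[s1F /eqP ex].
have [s2] := mass_gt0_exists py; rewrite inE => /andP[s2F /eqP ey].
have s1G := fiberG s1F; have s2G := fiberG s2F.
move: px py; rewrite -ex -ey !fiber_setU1// => px py.
have s21 : s2 \in fiber (from v.+1) s1.
  apply/fiberP; split=> // w' w'v.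
  by rewrite (fiberP _ _ _ s1F).2// (fiberP _ _ _ s2F).2.
have [th tth Dth] := tr s1G s21 px py.
have [thG _ _] := tth.
rewrite (cexp_translation _ px py tth) -[leRHS](cexp_cst px) lerBlDr -cexpD.
apply: (cexp_le (@fiber_ge0 _ s1)) => // s /fiberG sG.
have := XL _ _ sG (groupM thG sG).
have := d_move sG sG thG Dth; rewrite d_refl// add0n -(ler_nat R) => dd.
have := ler_wpM2l L0 dd; lra.
Qed.

End Chain.
End Recursion.
End Fibers.

(** * Configuration functions *)

Lemma sqr_sum_le (R : realFieldType) (I : finType) (A : {set I}) (a : I -> R) :
  (\sum_(i in A) a i) ^+ 2 <= #|A|%:R * \sum_(i in A) a i ^+ 2.
Proof.
have [->|A0] := eqVneq A finset.set0.
  by rewrite !big_set0 expr0n mulr0.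
have c0 : 0 < #|A|%:R :> R by rewrite ltr0n card_gt0.
pose S := \sum_(i in A) a i; pose t := S / #|A|%:R.
have : 0 <= \sum_(i in A) (a i - t) ^+ 2 by apply: sumr_ge0 => i _; exact: sqr_ge0.
rewrite (eq_bigr (fun i => a i ^+ 2 - 2 * t * a i + t ^+ 2)); last by move=> i _; ring.
rewrite big_split /= sumrB -mulr_sumr sumr_const -mulr_natl -/S.
have -> : S = #|A|%:R * t by rewrite /t mulrC divfK ?gt_eqF.
set Q := \sum_(i in A) _ => h; nra.
Qed.

Section SpecialValue.
Variables (R : realType) (n : nat) (G : {group 'S_n}) (D : nat).
Hypothesis D_gt0 : (0 < D)%N.
Implicit Types (s r th : 'S_n) (v w k m : 'I_n) (W Q : {set 'I_n}) (mu f X : 'S_n -> R).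
Implicit Types (al : 'I_n -> 'S_n -> R).

Notation fiber := (fiber G).

(** All [W] and [v] are needed because the order of revelation is not known beforehand: the next
    special point is drawn from the support of the current translation. *)
Definition homogeneous mu : Prop :=
  forall W v, v \notin W -> translatable G (fun th => (pdeg th <= D)%N) mu W v.

Definition config_cost al s r : R := \sum_k al k s * (s k != r k)%:R.

(** Budget of a point: [D^2] while ordinary, of which [D^2 - D] is released when it becomes special
    and the last [D] when it is fixed. As [al] is indexed by positions, the special value is charged
    at the position it occupies. *)
Definition pen_value W v al s : R :=
  (D%:R * al ((s^-1)%g v) s ^+ 2 +
   D%:R ^+ 2 * \sum_(w | w \notin (v |: W)%SET) al ((s^-1)%g w) s ^+ 2) / 2.

Definition pen_position Q m al s : R :=
  (D%:R * al m s ^+ 2 +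
   D%:R ^+ 2 * \sum_(k | k \notin (m |: Q)%SET) al k s ^+ 2) / 2.

Definition positions W s : {set 'I_n} := [set (s^-1)%g w | w in W]%SET.

Lemma mem_positions W s1 s k : s \in fiber W s1 ->
  (k \in positions W s1) = (s k \in W).
Proof.
move=> /fiberP[_ e]; apply/imsetP/idP => [[w wW ->]|sk].
  by rewrite -e// permKV.
by exists (s k) => //; rewrite -e// permK.
Qed.

Lemma fiber_inv W s1 s : s1 \in G ->
  ((s^-1)%g \in fiber (positions W s1) (s1^-1)%g) = (s \in fiber W s1).
Proof.
move=> s1G; apply/fiberP/fiberP => -[sG e].
  move: sG; rewrite groupV => sG; split=> // w wW.
  have := e _ (imset_f (fun w => (s1^-1)%g w) wW).
  by rewrite !invgK permKV => h; rewrite -[in LHS]h permK.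
rewrite groupV; split=> // k /imsetP[w wW ->].
by rewrite !invgK permKV -e// permKV.
Qed.

Lemma cexp_inv W s1 mu h : s1 \in G ->
  cexp (fiber (positions W s1) (s1^-1)%g) (fun s => mu (s^-1)%g) h =
  cexp (fiber W s1) mu (fun s => h (s^-1)%g).
Proof.
move=> s1G; rewrite /cexp /expect /mass (reindex_inj invg_inj).
rewrite [in X in _ / X](reindex_inj invg_inj) /=.
by congr (_ / _); apply: eq_big => s; rewrite ?fiber_inv// invgK.
Qed.

Lemma mass_inv W s1 mu : s1 \in G ->
  mass (fiber (positions W s1) (s1^-1)%g) (fun s => mu (s^-1)%g) = mass (fiber W s1) mu.
Proof.
move=> s1G; rewrite /mass (reindex_inj invg_inj).
by apply: eq_big => s; rewrite ?fiber_inv// invgK.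
Qed.

Lemma Lam_inv b W s1 mu X : s1 \in G ->
  Lam b (fiber (positions W s1) (s1^-1)%g) (fun s => mu (s^-1)%g) X =
  Lam b (fiber W s1) mu (fun s => X (s^-1)%g).
Proof. by move=> s1G; case: b; rewrite /= cexp_inv. Qed.

Lemma Psi_inv b W s1 mu f : s1 \in G ->
  Psi b (fiber (positions W s1) (s1^-1)%g) (fun s => mu (s^-1)%g) f =
  Psi b (fiber W s1) mu (fun s => f (s^-1)%g).
Proof. by move=> s1G; case: b; rewrite /= cexp_inv. Qed.

(** The coefficients depend on [s] alone, so the sum can be reindexed by [s]; and [k] differs from
    the position of [s k] in [r] exactly when [s k] differs from [r k]. *)
Lemma config_cost_inv al s r :
  config_cost (fun w s => al (s w) (s^-1)%g) (s^-1)%g (r^-1)%g = config_cost al s r.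
Proof.
rewrite /config_cost (reindex_inj (@perm_inj _ s)) /=.
apply: eq_bigr => k _; rewrite permK invgK; congr (_ * (_)%:R).
by rewrite eq_sym (can2_eq (permKV r) (permK r)).
Qed.

(** The law is quantified because every step passes to its image under inversion; for the same
    reason both homogeneity hypotheses are carried along. [N] bounds the number of unrevealed
    values. *)
Definition special_value_ineq (N : nat) : Prop :=
  forall b mu W s0 v al X f,
  {in G, forall s, 0 <= mu s} -> homogeneous mu -> homogeneous (fun s => mu (s^-1)%g) ->
  (#|~: W| <= N)%N -> s0 \in G -> v \notin W -> 0 < mass (fiber W s0) mu ->
  (forall k s, s \in G -> 0 <= al k s) ->
  {in fiber W s0 &, forall s r, X s - f r <= config_cost al s r} ->
  Lam b (fiber W s0) mu (fun s => X s - pen_value W v al s) <= Psi b (fiber W s0) mu f.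

(** Inversion turns the special position into a special value, and reindexing by [s] turns one
    penalty into the other. *)
Lemma special_position_ineq N b mu W s1 m al X f :
  special_value_ineq N ->
  {in G, forall s, 0 <= mu s} -> homogeneous mu -> homogeneous (fun s => mu (s^-1)%g) ->
  (#|~: W| <= N)%N -> s1 \in G -> m \notin positions W s1 ->
  0 < mass (fiber W s1) mu ->
  (forall k s, s \in G -> 0 <= al k s) ->
  {in fiber W s1 &, forall s r, X s - f r <= config_cost al s r} ->
  Lam b (fiber W s1) mu (fun s => X s - pen_position (positions W s1) m al s)
    <= Psi b (fiber W s1) mu f.
Proof.
move=> IH mu0 hmu hmuV cW s1G mQ m1 al0 Xf.
have := IH b (fun s => mu (s^-1)%g) (positions W s1) (s1^-1)%g m
  (fun w s => al (s w) (s^-1)%g) (fun s => X (s^-1)%g) (fun s => f (s^-1)%g).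
rewrite mass_inv// Lam_inv// Psi_inv//.
have -> : (fun s => mu ((s^-1)^-1)%g) = mu by apply: funext => s; rewrite invgK.
have -> : (fun s => f ((s^-1)^-1)%g) = f by apply: funext => s; rewrite invgK.
have e : (fun s => X ((s^-1)^-1)%g -
    pen_value (positions W s1) m (fun w s => al (s w) (s^-1)%g) (s^-1)%g) =
    (fun s => X s - pen_position (positions W s1) m al s).
  apply: funext => s; rewrite /pen_value /pen_position !invgK permK.
  congr (_ - (_ + _ * _) / 2).
  by apply: eq_bigr => w _; rewrite permK.
rewrite e; apply=> //.
- by move=> s sG; rewrite mu0 ?groupV.
- rewrite (_ : #|~: positions W s1| = #|~: W|)//; apply: (@addnI #|W|).
  by rewrite cardsC -[in LHS](card_imset W (@perm_inj _ (s1^-1)%g)) cardsC.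
- by rewrite groupV.
- by move=> k s sG; rewrite al0 ?groupV.
- move=> s r; rewrite -{1}(invgK s) -{1}(invgK r) !fiber_inv// => sF rF.
  have := Xf _ _ sF rF; rewrite -(config_cost_inv al) !invgK; exact.
Qed.

Lemma pen_valueE W v al s1 s : s1 \in G -> s \in fiber (v |: W)%SET s1 ->
  pen_value W v al s =
  (D%:R * al ((s1^-1)%g v) s ^+ 2 +
   D%:R ^+ 2 * \sum_(k | k \notin positions (v |: W)%SET s1) al k s ^+ 2) / 2.
Proof.
move=> s1G sF; rewrite /pen_value (fiberP _ _ _ _ sF).2 ?setU11//.
congr ((_ + _ * _) / 2); rewrite (reindex_inj (@perm_inj _ s)) /=.
by apply: eq_big => k; [rewrite (mem_positions _ sF)|rewrite permK].
Qed.

Lemma pen_positionE Q m al s : m \notin Q ->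
  pen_position Q m al s =
  (D%:R ^+ 2 * (\sum_(k | k \notin Q) al k s ^+ 2) -
     (D%:R ^+ 2 - D%:R) * al m s ^+ 2) / 2.
Proof.
move=> mQ; rewrite (bigD1 m)//= /pen_position.
rewrite [in LHS](eq_bigl (fun k => (k \notin Q) && (k != m))); first by ring.
by move=> k; rewrite !inE negb_or andbC.
Qed.

(** The next special position is uniform on [A], the support of [th] without the position [x1] being
    fixed. Its at most [D - 1] points share the released [D^2 - D], hence get at least [D] each, and
    [x1] releases its last [D]; by Cauchy-Schwarz this covers [Z^2], the support having at most [D]
    points. *)
Lemma special_value_step N : special_value_ineq N -> special_value_ineq N.+1.
Proof.
move=> IH b mu W s0 v al X f mu0 hmu hmuV cW s0G vW m0 al0 Xf.
have Fge0 W' s' : {in fiber W' s', forall s, 0 <= mu s} by apply: fiber_ge0.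
have D1 : 1 <= D%:R :> R by rewrite ler1n.
have DD : D%:R <= D%:R ^+ 2 :> R by nra.
apply: (Lam_le_Psi_piece (lab := fun s => (s^-1)%g v) (Fge0 _ _) m0) => x y w px py w01.
have [s1] := mass_gt0_exists px; rewrite inE => /andP[s1F /eqP ex].
have [s2] := mass_gt0_exists py; rewrite inE => /andP[s2F /eqP ey].
have s1G := fiberG s1F; have s2G := fiberG s2F.
move: px py; rewrite -ex -ey !fiber_setU1//; set W' := (v |: W)%SET => px py.
have cW' : (#|~: W'| <= N)%N.
  rewrite -ltnS; apply: leq_trans cW; apply: proper_card.
  by rewrite properC; apply/properP; split; [exact: finset.subsetUr|exists v; rewrite ?setU11].
have sub s : s \in fiber W' s1 -> s \in fiber W s0.
  by rewrite -(fiber_setU1 _ s1F) inE => /andP[].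
pose Q := positions W' s1; pose S s := \sum_(k | k \notin Q) al k s ^+ 2.
have inner m X' f' : m \notin Q ->
    {in fiber W' s1 &, forall s r, X' s - f' r <= config_cost al s r} ->
    Lam b (fiber W' s1) mu (fun s => X' s - pen_position Q m al s)
      <= Psi b (fiber W' s1) mu f'.
  by move=> mQ Xf'; apply: special_position_ineq IH _ _ _ _ _ _ _ _ _.
have penE s : s \in fiber W' s1 -> pen_value W v al s =
    (D%:R * al ((s1^-1)%g v) s ^+ 2 + D%:R ^+ 2 * S s) / 2 by exact: pen_valueE.
have S0 s : 0 <= S s by apply: sumr_ge0 => k _; exact: sqr_ge0.
(* The best piece may be the current one. Nothing is then moved, but a special position must still
   be named to apply the induction, unless the piece is a single permutation. *)
have [exy|nxy] := eqVneq ((s1^-1)%g v) ((s2^-1)%g v).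
  have e12 : fiber W' s2 = fiber W' s1.
    by rewrite -(fiber_setU1 _ s1F) -(fiber_setU1 _ s2F) exy.
  have le : Lam b (fiber W' s1) mu (fun s => X s - pen_value W v al s)
      <= Psi b (fiber W' s1) mu f.
    have [QT|[m mQ]] := set_0Vmem (~: Q).
      have e1 s : s \in fiber W' s1 -> s = s1.
        have -> : W' = [set: 'I_n]%SET.
          apply/eqP; rewrite eqEcard finset.subsetT /= cardsT card_ord.
          rewrite -(card_imset _ (@perm_inj _ (s1^-1)%g)) -/(positions W' s1) -/Q.
          by rewrite -(finset.setCK Q) QT finset.setC0 cardsT card_ord.
        exact: fiber_setT.
      have s1F' : s1 \in fiber W' s1 by apply/fiberP.
      apply: (@le_trans _ _ (X s1)).
        rewrite -[leRHS](Lam_cst px b); apply: (Lam_le (Fge0 _ _) px) => s sF.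
        rewrite penE// (e1 s sF) lerBlDr lerDl.
        have := S0 s1; have := sqr_ge0 (al ((s1^-1)%g v) s1); nra.
      apply: (Psi_ge (Fge0 _ _) px) => s /e1 ->; have := Xf _ _ s1F s1F.
      rewrite /config_cost big1 ?subr_le0// => k _; by rewrite eqxx mulr0.
    rewrite inE in mQ.
    apply: le_trans (inner m X f mQ _); last by move=> s r /sub sF /sub rF; exact: Xf.
    apply: (Lam_le (Fge0 _ _) px) => s sF.
    rewrite penE// pen_positionE// -/(S s).
    have := sqr_ge0 (al ((s1^-1)%g v) s); have := sqr_ge0 (al m s); nra.
  rewrite e12; apply: le_trans le _; have := sqr_ge0 w; lra.
have s21 : s2 \in fiber W s1.
  apply/fiberP; split=> // w' w'v.
  by rewrite (fiberP _ _ _ _ s1F).2// (fiberP _ _ _ _ s2F).2.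
have [th tth thD] := hmu W v vW _ _ s1G s21 px py.
have [thG eth _] := tth.
set x1 := (s1^-1)%g v in nxy *; have thv : th ((s2^-1)%g v) = x1 by rewrite eth ?setU11.
have x1th : x1 \in psupp th.
  rewrite inE; apply: contraNneq nxy => e.
  by apply/eqP/(@perm_inj _ th); rewrite e thv.
have x2th : (s2^-1)%g v \in psupp th by rewrite inE thv.
pose A := (psupp th :\ x1)%SET.
(* [s1] and [s2] agree on the positions of [W], so [th] fixes these: all points of [A] are
   unrevealed. *)
have AQ m : m \in A -> m \notin Q.
  rewrite !inE => /andP[mx1 thm]; apply/imsetP => -[w' w'W em].
  move: w'W mx1 thm; rewrite em => /setU1P[->|w'W]; first by rewrite eqxx.
  by move=> _; rewrite -{1}(fiberP _ _ _ _ s21).2// eth ?eqxx// inE w'W orbT.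
have cA : #|psupp th| = #|A|.+1 by rewrite (cardsD1 x1) x1th.
have A_gt0 : (0 < #|A|)%N.
  by rewrite card_gt0; apply/set0Pn; exists ((s2^-1)%g v); rewrite finset.in_setD1 eq_sym nxy x2th.
have cR : #|A|%:R + 1 <= D%:R :> R by rewrite natr1 -cA ler_nat.
have cR0 : 1 <= #|A|%:R :> R by rewrite ler1n.
pose p m : R := if m \in A then #|A|%:R^-1 else 0.
have p0 m : 0 <= p m by rewrite /p; case: ifP => // _; rewrite invr_ge0 ler0n.
have pE (F : 'I_n -> R) : \sum_m p m * F m = #|A|%:R^-1 * \sum_(m in A) F m.
  rewrite mulr_sumr [RHS]big_mkcond; apply: eq_bigr => m _; rewrite /p.
  by case: ifP => // _; rewrite mul0r.
have p1 : \sum_m p m = 1.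
  rewrite -[LHS](eq_bigr _ (fun m _ => mulr1 (p m))) pE sumr_const -mulr_natl mulr1.
  by rewrite mulVf// pnatr_eq0 -lt0n.
pose pin s := \sum_m p m * pen_position Q m al s.
have pinE s : pin s =
    (D%:R ^+ 2 * S s - (D%:R ^+ 2 - D%:R) * (#|A|%:R^-1 * \sum_(m in A) al m s ^+ 2)) / 2.
  rewrite /pin pE (eq_bigr (fun m =>
    (D%:R ^+ 2 * S s) / 2 - (D%:R ^+ 2 - D%:R) / 2 * al m s ^+ 2)); last first.
    by move=> m /AQ mQ; rewrite pen_positionE// -/(S s); ring.
  rewrite sumrB sumr_const -mulr_sumr -mulr_natl.
  by field; lra.
have avg X' f' : {in fiber W' s1 &, forall s r, X' s - f' r <= config_cost al s r} ->
    Lam b (fiber W' s1) mu (fun s => X' s - pin s) <= Psi b (fiber W' s1) mu f'.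
  move=> Xf'; rewrite -[leRHS]mul1r -p1 mulr_suml.
  have -> : (fun s => X' s - pin s) =
      (fun s => \sum_m p m * (X' s - pen_position Q m al s)).
    apply: funext => s; under [RHS]eq_bigr do rewrite mulrBr.
    by rewrite sumrB -mulr_suml p1 mul1r.
  apply: (Lam_mix (Fge0 _ _) px) => // m; rewrite /p; case: ifP => [mA _|]; last by rewrite eqxx.
  by apply: inner => //; exact: AQ.
pose Z s := \sum_(k in psupp th) al k s.
apply: (Lam_translation_le mu0 (pen_in := pin) (Z := Z) px py tth) => //.
- by apply: avg => s r /sub sF /sub rF; exact: Xf.
- apply: avg => s r /[dup] /sub sF /fiberG sG rF.
  have thr : (th * r)%g \in fiber W s0.
    have : (th * r)%g \in fiber W' s2 by rewrite (translation_fiber _ thG eth).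
    by rewrite -(fiber_setU1 _ s2F) inE => /andP[].
  have := Xf _ _ sF thr.
  suff : config_cost al s (th * r)%g <= config_cost al s r + Z s by lra.
  rewrite /config_cost /Z [X in _ + X]big_mkcond -big_split /=.
  apply: ler_sum => k _; rewrite permM inE.
  have ak := al0 k s sG; have [->|_] /= := eqVneq (th k) k; first by rewrite addr0.
  by do 2![case: (_ != _)]; rewrite ?mulr0 ?mulr1; lra.
- move=> s sF; apply: le_trans (sqr_sum_le _ _) _.
  rewrite penE// pinE (big_setD1 x1)//= -/A -/x1 cA -natr1.
  have a0 := sqr_ge0 (al x1 s).
  set SA := \sum_(i in A) _; have SA0 : 0 <= SA by apply: sumr_ge0 => k _; exact: sqr_ge0.
  have le1 : D%:R * SA <= (D%:R ^+ 2 - D%:R) * (#|A|%:R^-1 * SA).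
    rewrite mulrA ler_wpM2r// ler_pdivlMr; last by lra.
    by nra.
  nra.
Qed.

Lemma special_value N : special_value_ineq N.
Proof.
elim: N => [|N IH]; last exact: special_value_step.
move=> b mu W s0 v al X f _ _ _ + _ vW; rewrite leqn0 cards_eq0 => /eqP e.
by have := finset.in_set0 v; rewrite -e inE vW.
Qed.

(** The first special value is arbitrary, and its weight [D] is bounded by [D^2]. *)
Lemma Lam_config b mu al X f : (0 < n)%N ->
  {in G, forall s, 0 <= mu s} -> homogeneous mu -> homogeneous (fun s => mu (s^-1)%g) ->
  0 < mass G mu -> (forall k s, s \in G -> 0 <= al k s) ->
  {in G &, forall s r, X s - f r <= config_cost al s r} ->
  Lam b G mu (fun s => X s - D%:R ^+ 2 * sqnorm al s / 2) <= Psi b G mu f.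
Proof.
move=> n0 mu0 hmu hmuV m0 al0 Xf; have := @special_value #|~: (@finset.set0 'I_n)| b mu
  finset.set0 1%g (Ordinal n0) al X f mu0 hmu hmuV (leqnn _) (group1 G).
rewrite fiber_set0 inE => /(_ isT m0 al0 Xf); apply: le_trans.
apply: (Lam_le mu0 m0) => s sG; rewrite lerD2l lerN2 /pen_value ler_pM2r ?invr_gt0//.
rewrite /sqnorm [in leRHS](reindex_inj (@perm_inj _ (s^-1)%g)).
rewrite [in leRHS](bigD1 (Ordinal n0))//= mulrDr.
have D1 : 1 <= D%:R :> R by rewrite ler1n.
rewrite (eq_bigl (fun w => w != Ordinal n0)); last by move=> w; rewrite !inE orbF.
rewrite lerD2r ler_wpM2r ?sqr_ge0//; nra.
Qed.

End SpecialValue.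

(** * Uniform and product laws *)

Section UniformLaw.
Variables (R : realType) (n l : nat) (G : {group 'S_n}).
Implicit Types (s : 'S_n) (v : 'I_n) (W : {set 'I_n}).

(** Locality is applied to the composition of [s2] followed by the inverse of [s1]. It fixes the
    positions of [W], and the inclusion of supports makes [th] fix them as well. *)
Lemma uniform_translatable (mu : 'S_n -> R) W v :
  local_group l G -> uniform G mu ->
  translatable G (fun th => (pdeg th <= l)%N) mu W v.
Proof.
move=> loc unif s1 s2 s1G s21 _ _; have [s2G e21] := fiberP _ _ _ _ s21.
have [th [thG thS thD thv]] := loc (s2 * s1^-1)%g (groupM s2G (groupVr s1G))
  ((s2^-1)%g v) ((s1^-1)%g v) ltac:(by rewrite permM permKV).
exists th => //.
have eth w : w \in (v |: W)%SET -> th ((s2^-1)%g w) = (s1^-1)%g w.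
  move=> /setU1P[->//|wW]; rewrite e21//; apply/eqP/negPn/negP => nfix.
  have := fintype.subsetP thS ((s1^-1)%g w); rewrite !inE => /(_ nfix).
  by rewrite -{1}(e21 w wW) permM permKV eqxx.
have cst s' : mass (fiber G (v |: W)%SET s') mu =
    \sum_(s in fiber G (v |: W)%SET s') #|G|%:R^-1.
  by apply: eq_bigr => s /fiberG/unif.
split=> // s /fiberG sG; rewrite !unif ?groupM//; congr (_ * _).
by rewrite !cst (sum_translation _ thG eth).
Qed.

Lemma uniform_inv (mu : 'S_n -> R) : uniform G mu -> uniform G (fun s => mu (s^-1)%g).
Proof. by move=> unif s sG; rewrite unif ?groupV. Qed.

End UniformLaw.

(** * Product laws on a local base *)

Section ProductLaw.
Variables (R : realType) (n l : nat) (G : {group 'S_n}) (t : 'I_n -> 'I_n -> 'S_n).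
Hypothesis base_t : local_base l G t.
Implicit Types (s : 'S_n) (v w j : 'I_n) (i : {ffun 'I_n -> 'I_n}).

(** Natural indices, with the identity as default, allow the product to be cut at any level. *)
Definition factor i (k : nat) : 'S_n :=
  if insub k is Some j then (if (0 < k)%N then t (i j) j else 1%g) else 1%g.

Definition factors i (a b : nat) : 'S_n := \big[@perm_comp n/1%g]_(a <= k < b) factor i k.

Lemma perm_compA : associative (@perm_comp n).
Proof. by move=> a b c; rewrite /perm_comp mulgA. Qed.

Lemma perm_comp1g : left_id 1%g (@perm_comp n).
Proof. by move=> a; rewrite /perm_comp mulg1. Qed.

Lemma perm_compg1 : right_id 1%g (@perm_comp n).
Proof. by move=> a; rewrite /perm_comp mul1g. Qed.

HB.instance Definition _ :=
  Monoid.isLaw.Build 'S_n 1%g (@perm_comp n) perm_compA perm_comp1g perm_compg1.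

Lemma factorE i j : factor i j = if (0 < j)%N then t (i j) j else 1%g.
Proof. by rewrite /factor valK. Qed.

Lemma base_mapE i : base_map t i = factors i 0 n.
Proof.
rewrite /base_map /factors big_mkord big_mkcond /=.
by apply: eq_bigr => j _; rewrite factorE.
Qed.

Lemma base_map_split i v :
  base_map t i = (factors i v.+1 n * (factor i v * factors i 0 v))%g.
Proof.
rewrite base_mapE /factors (big_cat_nat (n := v)) ?(ltnW (ltn_ord v))//=.
by rewrite (big_ltn (ltn_ord v)) /perm_comp mulgA.
Qed.

Section Factors.
Variable i : {ffun 'I_n -> 'I_n}.
Hypothesis iF : i \in family (fix_orbit G).

Lemma factor_fix k : factor i k \in G /\
  (forall w, (k < w)%N -> factor i k w = w).
Proof.
rewrite /factor; case: insubP => [j jn jk|]; last by split=> // *; rewrite perm1.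
case: ifP => [j0|_]; last by split=> // *; rewrite perm1.
rewrite -jk in j0 *; have [t1 tj] := base_t j0.
have [->|ij] := eqVneq (i j) j; first by rewrite t1; split=> // *; rewrite perm1.
have [] := tj _ (familyP iF j) ij; rewrite inE => /andP[tG /forallP fx] _ _.
by split=> // w jw; apply/eqP; exact: (implyP (fx w)).
Qed.

Lemma factor_target v : factor i v (i v) = v.
Proof.
rewrite factorE; case: posnP => [v0|v0].
  by rewrite perm1; have := familyP iF v; rewrite fix_orbit0// inE => /eqP.
have [t1 tj] := base_t v0.
have [->|ij] := eqVneq (i v) v; first by rewrite t1 perm1.
by have [] := tj _ (familyP iF v) ij.
Qed.

Lemma factor_deg k : (pdeg (factor i k) <= l)%N.
Proof.
have d1 : (pdeg (1%g : 'S_n) <= l)%N.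
  rewrite /pdeg; suff -> : psupp (1%g : 'S_n) = finset.set0 by rewrite cards0.
  by apply/setP => w; rewrite !inE perm1 eqxx.
rewrite /factor; case: insubP => // j jn jk; case: ifP => // j0.
rewrite -jk in j0; have [t1 tj] := base_t j0.
have [->|ij] := eqVneq (i j) j; first by rewrite t1.
by have [] := tj _ (familyP iF j) ij.
Qed.

Lemma factors_in a b : factors i a b \in G.
Proof.
rewrite /factors; elim/big_ind: _ => // [x y xG yG|k _]; first by rewrite groupM.
by have [] := factor_fix k.
Qed.

Lemma factors_fix a b w : (b <= w)%N -> factors i a b w = w.
Proof.
move=> bw; rewrite /factors big_nat; elim/big_ind: _; first by rewrite perm1.
  by move=> x y ex ey; rewrite /perm_comp permM ey ex.
by move=> k /andP[_ kb]; have [_ ->//] := factor_fix k; exact: leq_trans bw.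
Qed.

Lemma base_map_in : base_map t i \in G.
Proof. by rewrite base_mapE factors_in. Qed.

(** The factors below [v] fix [v] and the factor at [v] sends [i v] to [v]: the position of [v]
    depends only on the digits from [v] on. *)
Lemma base_mapV v : ((base_map t i)^-1)%g v = ((factors i v.+1 n)^-1)%g (i v).
Proof.
apply: (canLR (permK _)).
by rewrite (base_map_split i v) !permM permKV factor_target factors_fix.
Qed.

End Factors.

Lemma factor_eq i i' v : i v = i' v -> factor i v = factor i' v.
Proof. by rewrite !factorE => ->. Qed.

Lemma factors_eq i i' a b : (b <= n)%N ->
  (forall w, (a <= w < b)%N -> i w = i' w) -> factors i a b = factors i' a b.
Proof.
move=> bn e; apply: eq_big_nat => k /[dup] kab /andP[_ kb].
exact: (@factor_eq i i' (Ordinal (leq_trans kb bn)) (e (Ordinal _) kab)).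
Qed.

(** Decoding from the top: once the digits above [w] are known, the position of [w] gives [i w]. In
    particular [base_map] is injective on digit families. *)
Lemma digits_eq i i' v : i \in family (fix_orbit G) -> i' \in family (fix_orbit G) ->
  (forall w, (v <= w)%N -> ((base_map t i)^-1)%g w = ((base_map t i')^-1)%g w) ->
  forall w, (v <= w)%N -> i w = i' w.
Proof.
move=> iF i'F e.
have H m w : (v <= w)%N -> (n <= w + m)%N -> i w = i' w.
  elim: m w => [|m IH] w vw; first by rewrite addn0 leqNgt ltn_ord.
  move=> nwm; have := e w vw; rewrite !base_mapV//.
  rewrite (@factors_eq i i')//; first by move=> /perm_inj.
  move=> w' /andP[ww' _]; apply: IH; first exact: leq_trans vw (ltnW ww').
  by apply: leq_trans nwm _; rewrite addnS -addSn leq_add2r.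
by move=> w vw; apply: (H n) => //; rewrite leq_addl.
Qed.

Definition update i v (y : 'I_n) : {ffun 'I_n -> 'I_n} :=
  [ffun w => if w == v then y else i w].

Lemma update_family i v y : i \in family (fix_orbit G) -> y \in fix_orbit G v ->
  update i v y \in family (fix_orbit G).
Proof.
move=> /familyP iF yO; apply/familyP => w; rewrite ffunE.
by case: eqP => [->|_] //; exact: iF.
Qed.

Lemma base_map_update i v y : base_map t (update i v y) =
  (factors i v.+1 n * (factor (update i v y) v * factors i 0 v))%g.
Proof.
rewrite (base_map_split _ v); congr (_ * (_ * _))%g; apply: factors_eq => //.
- by move=> w /andP[vw _]; rewrite ffunE -(inj_eq val_inj) gtn_eqF.
- exact: ltnW.
- by move=> w wv; rewrite ffunE -(inj_eq val_inj) ltn_eqF.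
Qed.

Lemma pdeg_conj s (x : 'S_n) : pdeg (x * s * x^-1)%g = pdeg s.
Proof.
rewrite /pdeg -(card_imset (mem (psupp s)) (@perm_inj _ (x^-1)%g)).
apply: eq_card => k; rewrite inE; apply/idP/imsetP => [h|[j]].
  exists (x k); rewrite ?permK// inE; apply: contraNneq h => e.
  by rewrite !permM e permK.
rewrite inE => h ->; apply: contraNneq h; rewrite !permM permKV.
by move=> /perm_inj ->.
Qed.

Lemma pdegV s : pdeg (s^-1)%g = pdeg s.
Proof.
apply: eq_card => k; rewrite !inE; congr (~~ _).
by rewrite (can2_eq (permKV s) (permK s)) eq_sym.
Qed.

(* Both factors move their common target j, unless one of them is trivial. *)
Lemma pdeg_mulV_le s1 s2 j (i1 i2 : 'I_n) : (0 < l)%N -> (pdeg s1 <= l)%N -> (pdeg s2 <= l)%N ->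
  s1 i1 = j -> s2 i2 = j -> (i1 = j -> s1 = 1%g) -> (i2 = j -> s2 = 1%g) ->
  (pdeg (s2 * s1^-1)%g <= 2 * l - 1)%N.
Proof.
move=> l0 d1 d2 e1 e2 t1 t2.
have [/t1 ->|n1] := eqVneq i1 j; first by rewrite invg1 mulg1; lia.
have [/t2 ->|n2] := eqVneq i2 j; first by rewrite mul1g pdegV; lia.
have js1 : j \in psupp s1.
  by rewrite inE; apply: contraNneq n1; rewrite -{2}e1 => /perm_inj ->.
have js2 : j \in psupp s2.
  by rewrite inE; apply: contraNneq n2; rewrite -{2}e2 => /perm_inj ->.
have sub : psupp (s2 * s1^-1)%g \subset (psupp s1 :|: psupp s2)%SET.
  apply/fintype.subsetP => k; rewrite !inE; apply: contraNT; rewrite negb_or !negbK.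
  by move=> /andP[/eqP f1 /eqP f2]; rewrite permM f2 -{1}f1 permK.
rewrite /pdeg in d1 d2 *; apply: leq_trans (subset_leq_card sub) _.
have := cardsUI (psupp s1) (psupp s2).
have : (0 < #|psupp s1 :&: psupp s2|)%N.
  by rewrite card_gt0; apply/set0Pn; exists j; rewrite finset.in_setI js1.
by lia.
Qed.

Variable mu : 'S_n -> R.
Variable nu : 'I_n -> 'I_n -> R.
Hypothesis mu_nu : forall s, s \in G ->
  mu s = \sum_(i in family (fix_orbit G) | base_map t i == s)
           \prod_(j < n | (0 < j)%N) nu j (i j).

Lemma mu_base_map i : i \in family (fix_orbit G) ->
  mu (base_map t i) = \prod_(j < n | (0 < j)%N) nu j (i j).
Proof.
move=> iF; rewrite mu_nu ?base_map_in// (bigD1 i) ?iF ?eqxx//= [X in _ + X]big1 ?addr0//.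
move=> i' /andP[/andP[i'F /eqP e]] /eqP[]; apply/ffunP => w.
by apply: (@digits_eq i' i w) => // w' _; rewrite e.
Qed.

Lemma mass_gt0_digits (A : {set 'S_n}) : {subset A <= G} -> 0 < mass A mu ->
  exists i, [/\ i \in family (fix_orbit G), base_map t i \in A & mu (base_map t i) != 0].
Proof.
move=> AG mA; have [s sA mus] : exists2 s, s \in A & mu s != 0.
  apply/exists_inP; apply: contraTT mA; rewrite negb_exists_in => /forall_inP na.
  by rewrite /mass big1 ?ltxx// => s /na; rewrite negbK => /eqP.
have : exists2 i, i \in family (fix_orbit G) & base_map t i == s.
  apply/exists_inP; apply: contraNT mus; rewrite negb_exists_in => /forall_inP na.
  by rewrite mu_nu ?AG// big1// => i /andP[/na/negbTE ->].
by move=> [i iF /eqP e]; exists i; rewrite e.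
Qed.

Definition two_moves (th : 'S_n) : Prop :=
  (pdeg th <= 2 * l - 1)%N /\
  exists x y : 'S_n, [/\ x \in G, y \in G, (pdeg x <= l)%N, (pdeg y <= l)%N & th = (x * y)%g].

(** Exchanging the digit [y1] at level [v] for [y2] is left multiplication by [th], a conjugate of
    the quotient of two base elements, and multiplies the mass by [nu v y2 / nu v y1]. Conjugation
    preserves degrees. *)
Lemma product_translatable v : (0 < l)%N ->
  translatable G two_moves mu (from n v.+1) v.
Proof.
move=> l0 s1 s2 s1G s21 m1 m2; have [s2G e21] := fiberP _ _ _ _ s21.
rewrite from_setU1 in m1 m2 *.
have [i1 [i1F i1s mui1]] := mass_gt0_digits (@fiberG _ _ _ _) m1.
have [i2 [i2F i2s mui2]] := mass_gt0_digits (@fiberG _ _ _ _) m2.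
have fE s w : s \in fiber G (from n v) s1 -> (v <= w)%N -> (s^-1)%g w = (s1^-1)%g w.
  by move=> /fiberP[_ e] vw; rewrite e// inE.
have fE2 s w : s \in fiber G (from n v) s2 -> (v <= w)%N -> (s^-1)%g w = (s2^-1)%g w.
  by move=> /fiberP[_ e] vw; rewrite e// inE.
pose B := factors i1 v.+1 n.
have e12 w : (v < w)%N -> i1 w = i2 w.
  move=> vw; apply: (@digits_eq _ _ w) => // w' ww'.
  have vw' := leq_trans vw ww'.
  by rewrite (fE _ w' i1s) ?(fE2 _ w' i2s) ?(ltnW vw')// e21// inE.
have B2 : factors i2 v.+1 n = B.
  by apply: factors_eq => // w /andP[vw _]; rewrite e12.
pose y1 := i1 v; pose y2 := i2 v.
have y1O : y1 \in fix_orbit G v by exact: familyP i1F v.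
have y2O : y2 \in fix_orbit G v by exact: familyP i2F v.
pose T1 := factor i1 v; pose T2 := factor i2 v.
pose th := (B * (T2 * T1^-1) * B^-1)%g.
have [T1G T1f] := factor_fix i1F v; have [T2G T2f] := factor_fix i2F v.
have BG : B \in G by exact: factors_in.
have thG : th \in G by rewrite /th !(groupM, groupV).
have thU i : i \in family (fix_orbit G) -> (forall w, (v <= w)%N -> i w = i1 w) ->
    (th * base_map t i)%g = base_map t (update i v y2).
  move=> iF ei; rewrite base_map_update (base_map_split _ v).
  have -> : factors i v.+1 n = B.
    by apply: factors_eq => // w /andP[vw _]; rewrite ei ?(ltnW vw).
  rewrite (factor_eq (ei v (leqnn v))) (@factor_eq (update i v y2) i2 v); last first.
    by rewrite ffunE eqxx.
  by rewrite /th -/T1 -/T2 !mulgA mulgKV mulgKV.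
have eth w : w \in from n v -> th ((s2^-1)%g w) = (s1^-1)%g w.
  rewrite inE => vw; rewrite -(fE _ _ i1s vw) -(fE2 _ _ i2s vw).
  have -> : ((base_map t i2)^-1)%g w = ((base_map t (update i1 v y2))^-1)%g w.
    have uF := update_family i1F y2O.
    have eu w' : (v <= w')%N -> i2 w' = update i1 v y2 w'.
      rewrite ffunE; have [->//|nw] := eqVneq w' v.
      by rewrite leq_eqVlt eq_sym (inj_eq val_inj) (negbTE nw) => /e12.
    rewrite !base_mapV// eu// (@factors_eq i2 (update i1 v y2))// => w' /andP[ww' _].
    by rewrite eu// (leq_trans vw (ltnW ww')).
  by rewrite -(thU _ i1F)// invMg (permM (base_map t i1)^-1) permKV.
(* Level 0 carries no factor in the product, so its ratio is set to 1. *)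
pose c1 := if (0 < v)%N then nu v y1 else 1.
pose c2 := if (0 < v)%N then nu v y2 else 1.
have prodE i : \prod_(j < n | (0 < j)%N) nu j (i j) =
    (if (0 < v)%N then nu v (i v) else 1) * \prod_(j < n | (0 < j)%N && (j != v)) nu j (i j).
  case: ifP => v0; first by rewrite (bigD1 v).
  rewrite mul1r; apply: eq_bigl => j; case: eqP => [->|_]; rewrite ?v0// andbT//.
have c1N0 : c1 != 0.
  by apply: contraNneq mui1; rewrite mu_base_map// prodE -/y1 -/c1 => ->; rewrite mul0r.
have key s : s \in fiber G (from n v) s1 -> c1 * mu (th * s)%g = c2 * mu s.
  move=> sF; have sG := fiberG sF.
  have [/exists_inP[i iF /eqP ei]|] := boolP [exists i in family (fix_orbit G), base_map t i == s].
    have di w : (v <= w)%N -> i w = i1 w.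
      apply: digits_eq => // w' vw'; rewrite ei.
      by rewrite (fE _ w' sF)// (fE _ w' i1s).
    rewrite -ei (thU i iF di) !mu_base_map ?update_family// !prodE ffunE eqxx.
    rewrite (di v)// -/y1 -/c1 -/c2 mulrCA; congr (_ * (_ * _)).
    by apply: eq_bigr => j /andP[_ /negbTE jv]; rewrite ffunE jv.
  (* If [s] has no digits, neither has [th * s]: putting [y1] back at level [v] would give digits
     for [s]. Both masses vanish. *)
  rewrite negb_exists_in => /forall_inP na.
  have -> : mu s = 0 by rewrite mu_nu// big1// => i /andP[/na/negbTE ->].
  rewrite (mu_nu (groupM thG sG)) big1 ?mulr0// => i /andP[iF /eqP ei].
  have thsF : (th * s)%g \in fiber G (from n v) s2 by rewrite (translation_fiber _ thG eth).
  have di w : (v <= w)%N -> i w = i2 w.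
    apply: digits_eq => // w' vw'; rewrite ei.
    by rewrite (fE2 _ w' thsF)// (fE2 _ w' i2s).
  have uF := update_family iF y1O.
  have /negP[] := na _ uF; rewrite -(inj_eq (mulgI th)) thU//.
    rewrite -ei; apply/eqP; congr base_map; apply/ffunP => w; rewrite !ffunE.
    by case: eqP => // ->; rewrite di.
  move=> w; rewrite ffunE; have [->//|nw] := eqVneq w v.
  rewrite leq_eqVlt eq_sym (inj_eq val_inj) (negbTE nw) => /= vw.
  by rewrite di ?e12// ltnW.
have keyM : c1 * mass (fiber G (from n v) s2) mu = c2 * mass (fiber G (from n v) s1) mu.
  by rewrite /mass (sum_translation _ thG eth) !mulr_sumr; apply: eq_bigr => s /key.
have triv i : i v = v -> factor i v = 1%g.
  by move=> e; rewrite factorE; case: ifP => // /base_t[+ _]; rewrite e.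
exists th; split.
- exact: thG.
- by move=> w; exact: eth.
- move=> s sF; apply: (mulfI c1N0); rewrite mulrA key// mulrAC -keyM.
  by rewrite -!mulrA; congr (_ * _); rewrite mulrC.
- rewrite pdeg_conj; apply: (@pdeg_mulV_le T1 T2 v y1 y2) => //.
  + exact: factor_deg.
  + exact: factor_deg.
  + exact: factor_target.
  + exact: factor_target.
  + exact: triv.
  + exact: triv.
- exists (B * T2 * B^-1)%g, (B * T1^-1 * B^-1)%g; split.
  + by rewrite !(groupM, groupV).
  + by rewrite !(groupM, groupV).
  + by rewrite pdeg_conj factor_deg.
  + by rewrite pdeg_conj pdegV factor_deg.
  + by rewrite /th !mulgA mulgKV.
Qed.

End ProductLaw.

(** * All orders of the values from one, by conjugation *)

Section Conjugation.
Variables (R : realType) (n D : nat) (G : {group 'S_n}) (mu : 'S_n -> R).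
Hypothesis G_norm : (G <| [set: 'S_n])%g.
Hypothesis mu_conj : forall s (x : 'S_n), s \in G -> mu s = mu (s ^ x)%g.
Implicit Types (s x : 'S_n) (v w : 'I_n) (W : {set 'I_n}).

Lemma memJ_G s x : ((s ^ x)%g \in G) = (s \in G).
Proof. by apply: memJ_norm; apply: (fintype.subsetP (normal_norm G_norm)); rewrite inE. Qed.

Lemma conjV_perm s x w : (((s ^ x)^-1)%g (x w)) = x ((s^-1)%g w).
Proof. by rewrite -conjVg conjgE !permM permK. Qed.

Lemma fiber_conj W s1 x s :
  ((s ^ x)%g \in fiber G (x @: W)%SET (s1 ^ x)%g) = (s \in fiber G W s1).
Proof.
apply/fiberP/fiberP; rewrite memJ_G => -[sG e]; split=> // w.
  by move=> wW; have := e _ (imset_f x wW); rewrite !conjV_perm => /perm_inj.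
by move=> /imsetP[u uW ->]; rewrite !conjV_perm e.
Qed.

Lemma mass_conj W s1 x :
  mass (fiber G (x @: W)%SET (s1 ^ x)%g) mu = mass (fiber G W s1) mu.
Proof.
rewrite /mass (reindex_inj (conjg_inj x)) /=.
by apply: eq_big => s; rewrite fiber_conj// => /fiberG sG; rewrite -mu_conj.
Qed.

Lemma pdegJ s x : pdeg (s ^ x)%g = pdeg s.
Proof. by have := pdeg_conj s x^-1; rewrite invgK -mulgA. Qed.

(** Conjugation by [x] relabels values and positions simultaneously and preserves [G], [mu] and
    degrees. *)
Lemma translatable_conj W v x :
  translatable G (fun th => (pdeg th <= D)%N) mu (x @: W)%SET (x v) ->
  translatable G (fun th => (pdeg th <= D)%N) mu W v.
Proof.
move=> tr s1 s2 s1G s21 m1 m2.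
have [||||th [thG eth emu] thD] := tr (s1 ^ x)%g (s2 ^ x)%g.
- by rewrite memJ_G.
- by rewrite fiber_conj.
- by rewrite -imsetU1 mass_conj.
- by rewrite -imsetU1 mass_conj.
exists (th ^ x^-1)%g; last by rewrite pdegJ.
rewrite -imsetU1 in eth emu.
split; first by rewrite memJ_G.
  move=> w wW; apply: (@perm_inj _ x).
  by rewrite -[RHS]conjV_perm -eth ?imset_f// conjV_perm conjgE invgK !permM permKV.
move=> s sF; have := emu (s ^ x)%g; rewrite fiber_conj => /(_ sF).
rewrite !mass_conj -mu_conj ?(fiberG sF)// => <-; congr (_ * _).
rewrite (mu_conj x); first by rewrite conjMg conjgKV.
by rewrite groupM ?memJ_G// (fiberG sF).
Qed.

(** List the remaining values, then [v], then [W]: the rank in this list is the required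
    relabelling. *)
Lemma perm_to_from W v : v \notin W ->
  exists (x : 'S_n) (j : 'I_n), (x @: W)%SET = from n j.+1 /\ x v = j.
Proof.
move=> vW; pose A := enum (~: (v |: W))%SET; pose sq := A ++ v :: enum W.
have memA w : (w \in A) = (w != v) && (w \notin W) by rewrite mem_enum !inE negb_or.
have sq_uniq : uniq sq.
  rewrite cat_uniq enum_uniq /= negb_or memA eqxx /= mem_enum vW enum_uniq !andbT.
  by apply/hasPn => w; rewrite mem_enum memA => ->; rewrite andbF.
have sq_mem w : w \in sq.
  by rewrite mem_cat inE memA mem_enum; case: (w == v); case: (w \in W).
have sq_size : size sq = n.
  rewrite -[RHS]card_ord -(card_uniqP sq_uniq); apply: eq_card => w.
  by rewrite sq_mem.
have nth_inj : injective (fun i : 'I_n => nth v sq i).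
  by move=> i j /eqP; rewrite nth_uniq ?sq_size// => /eqP/val_inj.
pose y := perm nth_inj.
have jn : (size A < n)%N.
  have : (size A < size sq)%N by rewrite size_cat /= addnS ltnS leq_addr.
  by rewrite sq_size.
have yE i : y i = nth v sq i by rewrite permE.
exists (y^-1)%g, (Ordinal jn); split; last first.
  by apply: (canLR (permK y)); rewrite yE /= nth_cat ltnn subnn.
have yW i : (y i \in W) = (size A < i)%N.
  rewrite yE nth_cat; case: ltngtP => [iA|Ai|->].
  - by have := mem_nth v iA; rewrite memA => /andP[_ /negbTE].
  - have : (i < size sq)%N by rewrite sq_size.
    rewrite size_cat /= -(ltn_subLR _ (ltnW Ai)) => h.
    rewrite -(subnSK Ai) /= -mem_enum mem_nth//.
    by move: h; rewrite -(subnSK Ai) ltnS.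
  - by rewrite subnn /=; exact/negbTE.
apply/setP => i; rewrite inE -yW; apply/imsetP/idP => [[w wW ->]|yi].
  by rewrite permKV.
by exists (y i); rewrite // permK.
Qed.

Lemma homogeneous_conj :
  (forall v, translatable G (fun th => (pdeg th <= D)%N) mu (from n v.+1) v) ->
  homogeneous G D mu.
Proof.
move=> tr W v vW; have [x [j [xW xv]]] := perm_to_from vW.
by apply: (@translatable_conj W v x); rewrite xW xv.
Qed.

End Conjugation.

(** * Deviation inequalities *)

Section Distances.
Variables (n l : nat) (G : {group 'S_n}).
Implicit Types (s r q th : 'S_n).

Lemma dHxx s : dH s s = 0%N.
Proof. by rewrite dHE big1// => i _; rewrite eqxx. Qed.

Lemma dHC s r : dH s r = dH r s.
Proof. by rewrite !dHE; apply: eq_bigr => i _; rewrite eq_sym. Qed.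

Lemma dH_move s r th : (dH s (th * r)%g <= dH s r + pdeg th)%N.
Proof.
rewrite !dHE /pdeg -sum1_card [X in (_ + X)%N]big_mkcond -big_split /=.
apply: leq_sum => i _; rewrite permM inE.
have [->|_] /= := eqVneq (th i) i; first by rewrite addn0.
by rewrite addn1; case: (s i != _).
Qed.

Lemma pdeg_le_n th : (pdeg th <= n)%N.
Proof. by rewrite -[X in (_ <= X)%N]card_ord max_card. Qed.

Lemma reach_trans s r q a b : reach l G s r a -> reach l G r q b -> reach l G s q (a + b).
Proof.
move=> /existsP[x /andP[x1 /eqP x2]] /existsP[y /andP[y1 /eqP y2]].
apply/existsP; exists (cat_tuple x y); rewrite all_cat x1 y1 /=.
by rewrite foldl_cat x2 y2.
Qed.

Lemma reach0 s : reach l G s s 0.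
Proof. by apply/existsP; exists [tuple] => /=. Qed.

(** In composition order [th * r] is [r] followed on the right by [th], the side on which [dT]
    multiplies. *)
Lemma reach1 r th : th \in G -> (pdeg th <= l)%N -> reach l G r (th * r)%g 1.
Proof. by move=> thG thl; apply/existsP; exists [tuple th]; rewrite /= thG thl /=. Qed.

Variable t : 'I_n -> 'I_n -> 'S_n.
Hypothesis base_t : local_base l G t.

Lemma dT_le s r k : reach l G s r k -> (dT l G s r <= k)%N.
Proof.
move=> sr; rewrite /dT; case: pselect => // ex; case: ex_minnP => m _; exact.
Qed.

Lemma reach_dT s r : s \in G -> r \in G -> reach l G s r (dT l G s r).
Proof.
move=> sG rG; rewrite /dT; case: pselect => [ex|[]]; first by case: ex_minnP.
exact: local_base_reach base_t _ _ sG rG.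
Qed.

Lemma dTxx s : dT l G s s = 0%N.
Proof. by apply/eqP; rewrite -leqn0 dT_le// reach0. Qed.

Lemma dT_move s r q c : s \in G -> r \in G -> reach l G r q c ->
  (dT l G s q <= dT l G s r + c)%N.
Proof. by move=> sG rG rq; apply: dT_le; apply: reach_trans rq; exact: reach_dT. Qed.

Lemma two_moves_reach r th : r \in G -> two_moves l G th -> reach l G r (th * r)%g 2.
Proof.
move=> rG [_ [x [y [xG yG xl yl ->]]]]; rewrite -mulgA.
by rewrite -[2%N]/(1 + 1)%N; apply: (reach_trans (r := (y * r)%g)); exact: reach1.
Qed.

Lemma two_movesV th : two_moves l G th -> two_moves l G (th^-1)%g.
Proof.
move=> [th1 [x [y [xG yG xl yl e]]]]; split; first by rewrite pdegV.
by exists (y^-1)%g, (x^-1)%g; rewrite !groupV !pdegV e invMg.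
Qed.

End Distances.

(** * From exponential moments to tails *)

Section Chernoff.
Variables (R : realType) (T : finType) (A : {set T}) (mu : T -> R).
Hypothesis prob_mu : prob A mu.
Implicit Types (g h : T -> R).

Lemma expectE h : expect A mu h = cexp A mu h.
Proof. by rewrite /cexp /mass prob_mu.2 divr1. Qed.

Lemma mass_prob : 0 < mass A mu.
Proof. by rewrite /mass prob_mu.2. Qed.

Lemma prob_ge0 : {in A, forall s, 0 <= mu s}.
Proof. exact: prob_mu.1. Qed.

Lemma Pr_le_expect (E : pred T) h :
  {in A, forall s, 0 <= h s} -> {in A, forall s, E s -> 1 <= h s} ->
  Pr A mu E <= expect A mu h.
Proof.
move=> h0 h1; rewrite /Pr /expect [leRHS](bigID E) /= -[leLHS]addr0 lerD//.
  by apply: ler_sum => s /andP[sA Es]; rewrite ler_peMr ?prob_ge0 ?h1.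
by apply: sumr_ge0 => s /andP[sA _]; rewrite mulr_ge0 ?prob_ge0 ?h0.
Qed.

Lemma expectZ (k : R) h : expect A mu (fun s => k * h s) = k * expect A mu h.
Proof. by rewrite !expectE cexpZ. Qed.

Lemma sup_on_ge h s : s \in A -> h s <= sup_on A h.
Proof.
move=> sA; apply: ub_le_sup; last by exists s.
exists (\sum_(r in A) `|h r|) => _ [r /= rA <-].
rewrite (bigD1 r)//=; apply: le_trans (ler_norm _) _.
by rewrite lerDl sumr_ge0.
Qed.

Lemma exp_frac_scale (k a b : R) : 0 < k -> exp_frac (k * a) (k * b) = exp_frac a b.
Proof.
move=> k0; rewrite /exp_frac !mulf_eq0 gt_eqF//=; case: eqP => // /eqP b0.
by rewrite -mulf_div divff ?gt_eqF// mul1r.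
Qed.

(* The case q = 0 < u is covered by letting x tend to infinity. *)
Lemma exp_frac_opt (P u q : R) : 0 <= u -> 0 <= q ->
  (forall x, 0 <= x -> P <= expR (- (x * u) + x ^+ 2 * q)) ->
  P <= exp_frac (u ^+ 2) (4 * q).
Proof.
move=> u0 q0 le; rewrite /exp_frac mulf_eq0 pnatr_eq0 /= sqrf_eq0.
have [qz|qn0] := eqVneq q 0; last first.
  have qp : 0 < q by rewrite lt0r qn0.
  have := le (u / (2 * q)); rewrite divr_ge0 ?mulr_ge0// => /(_ isT) /le_trans; apply.
  by rewrite ler_expR le_eqVlt; apply/orP; left; apply/eqP; field.
have [uz|un0] := eqVneq u 0.
  by have := le 0 (lexx 0); rewrite mul0r expr0n mul0r oppr0 addr0 expR0.
have up : 0 < u by rewrite lt0r un0.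
rewrite leNgt; apply/negP => Pp.
(* At this [x] the hypothesis reads [P <= e^(-1/P)], contradicting [e^(1/P) >= 1 + 1/P > 1/P]. *)
have := le ((P * u)^-1); rewrite invr_ge0 mulr_ge0 ?(ltW Pp)// => /(_ isT).
rewrite qz mulr0 addr0 invfM -mulrA mulVf// mulr1 leNgt => /negP; apply.
have e := expR_ge1Dx P^-1; have P1 : P * P^-1 = 1 by rewrite divff ?gt_eqF.
rewrite expRN -[ltRHS]invrK ltf_pV2 ?posrE ?expR_gt0 ?invr_gt0//; lra.
Qed.

Lemma Pr_upper g (u q : R) : 0 <= u -> 0 <= q ->
  (forall x, 0 <= x ->
     expect A mu (fun s => expR (x * g s)) <= expR (x * expect A mu g + x ^+ 2 * q)) ->
  Pr A mu (fun s => expect A mu g + u <= g s) <= exp_frac (u ^+ 2) (4 * q).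
Proof.
move=> u0 q0 le; apply: exp_frac_opt => // x x0.
set m := expect A mu g.
apply: (@le_trans _ _ (expect A mu (fun s => expR (- (x * (m + u))) * expR (x * g s)))).
  apply: Pr_le_expect => s _; first by rewrite mulr_ge0 ?expR_ge0.
  move=> mg; rewrite -expRD -[leLHS]expR0 ler_expR addrC subr_ge0.
  by rewrite ler_wpM2l.
rewrite expectZ; apply: le_trans (ler_wpM2l (expR_ge0 _) (le x x0)) _.
by rewrite -expRD ler_expR -/m; lra.
Qed.

Lemma expectN g : expect A mu (fun s => - g s) = - expect A mu g.
Proof. by rewrite /expect -sumrN; apply: eq_bigr => s _; rewrite mulrN. Qed.

Lemma Pr_lower g (u q : R) : 0 <= u -> 0 <= q ->
  (forall x, 0 <= x ->
     expect A mu (fun s => expR (- (x * g s))) <= expR (- (x * expect A mu g) + x ^+ 2 * q)) ->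
  Pr A mu (fun s => g s <= expect A mu g - u) <= exp_frac (u ^+ 2) (4 * q).
Proof.
move=> u0 q0 le; have := @Pr_upper (fun s => - g s) u q u0 q0.
rewrite expectN => H; apply: le_trans (H _); last first.
  move=> x x0; rewrite mulrN; apply: le_trans (le x x0).
  by rewrite le_eqVlt; apply/orP; left; apply/eqP; apply: eq_bigr => s _; rewrite mulrN.
rewrite /Pr le_eqVlt; apply/orP; left; apply/eqP; apply: eq_bigl => s.
by rewrite [in RHS]lerNr opprD opprK.
Qed.

Lemma mgf_le_of_Lam g X : Lam true A mu X <= Psi true A mu g ->
  expect A mu (fun s => expR (X s)) <= expR (expect A mu g).
Proof.
rewrite !expectE /= => h; rewrite -[leLHS]lnK ?ler_expR// posrE.
by apply: cexp_gt0 => [||s _]; [exact: prob_ge0|exact: mass_prob|exact: expR_gt0].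
Qed.

Lemma mgfN_le_of_Lam f X : Lam false A mu X <= Psi false A mu f ->
  expect A mu (fun s => expR (- f s)) <= expR (- expect A mu X).
Proof.
rewrite !expectE /= lerNr => h; rewrite -[leLHS]lnK ?ler_expR// posrE.
by apply: cexp_gt0 => [||s _]; [exact: prob_ge0|exact: mass_prob|exact: expR_gt0].
Qed.

End Chernoff.

(** * Tails of configuration functions *)

Section ConfigTails.
Variables (R : realType) (n D : nat) (G : {group 'S_n}) (mu : 'S_n -> R).
Hypotheses (n_gt0 : (0 < n)%N) (D_gt0 : (0 < D)%N) (prob_mu : prob G mu).
Hypotheses (hmu : homogeneous G D mu) (hmuV : homogeneous G D (fun s => mu (s^-1)%g)).
Variables (g : 'S_n -> R) (c_sq : R) (alpha : 'I_n -> 'S_n -> R).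
Hypothesis c_sq_ge : D%:R ^+ 2 <= c_sq.
Hypothesis alpha0 : forall k s, s \in G -> 0 <= alpha k s.
Hypothesis g_alpha : forall r s, r \in G -> s \in G ->
  g r - g s <= \sum_k alpha k r * (r k != s k)%:R.

Let sq_ge0 s : 0 <= sqnorm alpha s.
Proof. by apply: sumr_ge0 => k _; exact: sqr_ge0. Qed.

Let c_sq_gt0 : 0 < c_sq.
Proof. by apply: lt_le_trans c_sq_ge; rewrite exprn_gt0// ltr0n. Qed.

Let esq_ge0 : 0 <= expect G mu (sqnorm alpha).
Proof. by apply: sumr_ge0 => s sG; rewrite mulr_ge0 ?(prob_ge0 prob_mu). Qed.

Lemma Lam_config_scaled b (x : R) : 0 <= x ->
  Lam b G mu (fun s => x * g s - x ^+ 2 * (c_sq * sqnorm alpha s / 2)) <=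
  Psi b G mu (fun s => x * g s).
Proof.
move=> x0; have m0 := mass_prob prob_mu; have mu0 := prob_ge0 prob_mu.
apply: le_trans (@Lam_config R n G D D_gt0 b mu (fun k s => x * alpha k s)
  (fun s => x * g s) _ n_gt0 mu0 hmu hmuV m0 _ _).
- apply: (Lam_le mu0 m0) => s _; rewrite lerD2l lerN2.
  have -> : sqnorm (fun k s => x * alpha k s) s = x ^+ 2 * sqnorm alpha s.
    by rewrite /sqnorm mulr_sumr; apply: eq_bigr => k _; rewrite exprMn.
  have -> : D%:R ^+ 2 * (x ^+ 2 * sqnorm alpha s) / 2 =
      x ^+ 2 * (D%:R ^+ 2 * sqnorm alpha s / 2) by ring.
  by rewrite ler_wpM2l ?sqr_ge0// ler_wpM2r ?invr_ge0// ler_wpM2r.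
- by move=> k s sG; rewrite mulr_ge0 ?alpha0.
- move=> s r sG rG; rewrite -mulrBr.
  have := ler_wpM2l x0 (g_alpha sG rG); rewrite mulr_sumr => /le_trans; apply.
  by apply: ler_sum => k _; rewrite mulrA.
Qed.

Lemma config_upper_mgf (x : R) : 0 <= x ->
  expect G mu (fun s => expR (x * g s - x ^+ 2 * (c_sq * sqnorm alpha s / 2)))
    <= expR (x * expect G mu g).
Proof.
by move=> x0; rewrite -(expectZ prob_mu); apply: mgf_le_of_Lam => //; exact: Lam_config_scaled.
Qed.

Lemma config_lower_mgf (x : R) : 0 <= x ->
  expect G mu (fun s => expR (- (x * g s))) <=
  expR (- (x * expect G mu g) + x ^+ 2 * (c_sq * expect G mu (sqnorm alpha) / 2)).
Proof.
move=> x0; have := mgfN_le_of_Lam prob_mu (Lam_config_scaled false x0).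
move=> /le_trans; apply; rewrite ler_expR le_eqVlt; apply/orP; left; apply/eqP.
rewrite !(expectE prob_mu) (@eq_cexp _ _ _ _ _ (fun s => x * g s +
  (- (x ^+ 2 * c_sq / 2)) * sqnorm alpha s)); last by move=> s _; lra.
by rewrite cexpD !cexpZ; lra.
Qed.

Lemma config_tails :
  [/\ forall v lambda : R, 0 <= v -> 0 <= lambda ->
          Pr G mu (fun s => expect G mu g + v + lambda * c_sq * sqnorm alpha s / 2 <= g s)
            <= expR (- (lambda * v)),
      forall u : R, 0 <= u ->
          Pr G mu (fun s => g s <= expect G mu g - u)
            <= exp_frac (u ^+ 2) (2 * c_sq * expect G mu (sqnorm alpha)),
      forall u : R, 0 <= u ->
          Pr G mu (fun s => expect G mu g + u <= g s)
            <= exp_frac (u ^+ 2) (2 * c_sq * sup_on G (sqnorm alpha)) &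
      forall M : R, 0 <= M ->
          (forall s, s \in G -> sqnorm alpha s <= M * g s) ->
          forall u : R, 0 <= u ->
          Pr G mu (fun s => expect G mu g + u <= g s)
            <= exp_frac (u ^+ 2) (2 * c_sq * M * (expect G mu g + u))].
Proof.
have c0 := ltW c_sq_gt0; set m := expect G mu g; split.
- move=> v x v0 x0.
  apply: (@le_trans _ _ (expect G mu (fun s => expR (- (x * (m + v))) *
      expR (x * g s - x ^+ 2 * (c_sq * sqnorm alpha s / 2))))).
    apply: Pr_le_expect => // s _; first by rewrite mulr_ge0 ?expR_ge0.
    move=> le; rewrite -expRD -[leLHS]expR0 ler_expR.
    have := ler_wpM2l x0 le; lra.
  rewrite (expectZ prob_mu); apply: le_trans (ler_wpM2l (expR_ge0 _) (config_upper_mgf x0)) _.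
  by rewrite -expRD ler_expR -/m; lra.
- move=> u u0.
  have -> : 2 * c_sq * expect G mu (sqnorm alpha) =
      4 * (c_sq * expect G mu (sqnorm alpha) / 2) by lra.
  apply: Pr_lower => //; last exact: config_lower_mgf.
  by rewrite divr_ge0// mulr_ge0// ltW.
- move=> u u0.
  have sup0 : 0 <= sup_on G (sqnorm alpha).
    by apply: le_trans (sup_on_ge (sqnorm alpha) (group1 G)).
  have -> : 2 * c_sq * sup_on G (sqnorm alpha) = 4 * (c_sq * sup_on G (sqnorm alpha) / 2) by lra.
  have q0 : 0 <= c_sq * sup_on G (sqnorm alpha) / 2.
    by rewrite divr_ge0// mulr_ge0// ltW.
  apply: Pr_upper => // x x0.
  apply: (@le_trans _ _ (expect G mu (fun s =>
      expR (x ^+ 2 * (c_sq * sup_on G (sqnorm alpha) / 2)) *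
      expR (x * g s - x ^+ 2 * (c_sq * sqnorm alpha s / 2))))).
    apply: ler_sum => s sG; rewrite ler_wpM2l ?(prob_ge0 prob_mu)// -expRD ler_expR.
    rewrite addrCA lerDl subr_ge0 ler_wpM2l ?sqr_ge0// ler_wpM2r ?invr_ge0//.
    rewrite ler_wpM2l ?(ltW c_sq_gt0)//.
    exact: sup_on_ge.
  rewrite (expectZ prob_mu).
  apply: le_trans (ler_wpM2l (expR_ge0 _) (config_upper_mgf x0)) _.
  by rewrite -expRD addrC.
- move=> M M0 self u u0.
  have gM s : s \in G -> 0 <= M * g s by move=> sG; apply: le_trans (self s sG).
  have Pr1 (E : pred 'S_n) : Pr G mu E <= 1.
    rewrite -prob_mu.2 /Pr [leRHS](bigID E) /= lerDl.
    by apply: sumr_ge0 => s /andP[/(prob_ge0 prob_mu)].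
  have mM : 0 <= M * m.
    rewrite -(expectZ prob_mu); apply: sumr_ge0 => s sG.
    by rewrite mulr_ge0 ?(prob_ge0 prob_mu)// gM.
  pose q := c_sq * M * (m + u) / 2; have qE : q = c_sq * M * (m + u) / 2 by [].
  clearbody q.
  have -> : 2 * c_sq * M * (m + u) = 4 * q by rewrite qE; lra.
  have q0 : 0 <= q.
    rewrite qE divr_ge0// -mulrA mulr_ge0 ?(ltW c_sq_gt0)// mulrDr addr_ge0// mulr_ge0//.
  (* After [|alpha|^2 <= M g] the exponent is [x (1 - x c_sq M / 2) g], nondecreasing in [g] under
     the restriction on [x], hence smallest at [g = m + u] on the event. The optimal [x = u / (2 q)]
     satisfies the restriction because [M m >= 0]. *)
  have bound (x : R) : 0 <= x -> x * (c_sq * M) <= 2 ->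
      Pr G mu (fun s => m + u <= g s) <= expR (- (x * u) + x ^+ 2 * q).
    move=> x0 x2.
    apply: (@le_trans _ _ (expect G mu (fun s => expR (- (x * (m + u)) + x ^+ 2 * q) *
        expR (x * g s - x ^+ 2 * (c_sq * sqnorm alpha s / 2))))).
      apply: Pr_le_expect => // s sG; first by rewrite mulr_ge0 ?expR_ge0.
      move=> le; rewrite -expRD -[leLHS]expR0 ler_expR qE.
      have h1 : x ^+ 2 * (c_sq * sqnorm alpha s / 2) <= x ^+ 2 * (c_sq * (M * g s) / 2).
        by rewrite ler_wpM2l ?sqr_ge0// ler_wpM2r ?invr_ge0// ler_wpM2l ?(ltW c_sq_gt0)// self.
      have h2 : 0 <= x * (2 - x * (c_sq * M)) * (g s - (m + u)).
        by rewrite mulr_ge0 ?mulr_ge0 ?subr_ge0.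
      lra.
    rewrite (expectZ prob_mu).
    apply: le_trans (ler_wpM2l (expR_ge0 _) (config_upper_mgf x0)) _.
    by rewrite -expRD ler_expR -/m; lra.
  have [qz|qn0] := eqVneq q 0; last first.
    have qp : 0 < q by rewrite lt0r qn0.
    rewrite /exp_frac mulf_eq0 pnatr_eq0 /= (negbTE qn0).
    have := bound (u / (2 * q)); rewrite divr_ge0 ?mulr_ge0// => /(_ isT) H.
    apply: le_trans (H _) _.
      rewrite mulrAC ler_pdivrMr ?mulr_gt0// qE.
      have cMm : 0 <= c_sq * (M * m) by exact: mulr_ge0.
      have cMu : 0 <= c_sq * (M * u) by rewrite !mulr_ge0.
      lra.
    by rewrite ler_expR le_eqVlt; apply/orP; left; apply/eqP; field.
  have [uz|un0] := eqVneq u 0.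
    by rewrite /exp_frac qz mulr0 eqxx uz expr0n eqxx Pr1.
  have up : 0 < u by rewrite lt0r un0.
  (* As [M m >= 0] and [u > 0], [q = 0] forces [M = 0]; the restriction on [x] disappears and [x]
     may tend to infinity. *)
  have Mz : M = 0.
    apply/eqP; apply: contraTT isT => Mn0.
    have Mp : 0 < M by rewrite lt0r Mn0.
    have : 0 < q by rewrite qE divr_gt0// -mulrA mulr_gt0// mulrDr ltr_wpDl// mulr_gt0.
    by rewrite qz ltxx.
  rewrite qz; apply: exp_frac_opt => // x x0; rewrite -qz; apply: bound => //.
  by rewrite Mz !mulr0.
Qed.

End ConfigTails.

(** * Tails of functions controlled by a distance *)

Section MetricTails.
Variables (R : realType) (n : nat) (G : {group 'S_n}) (mu : 'S_n -> R).
Hypothesis prob_mu : prob G mu.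
Variables (D : 'S_n -> Prop) (d : 'S_n -> 'S_n -> nat) (c : nat).
Hypothesis tr : forall v : 'I_n, translatable G D mu (from n v.+1) v.
Hypothesis d_refl : forall s, s \in G -> d s s = 0%N.
Hypothesis d_move : forall s r th, s \in G -> r \in G -> th \in G -> D th ->
  (d s (th * r)%g <= d s r + c)%N.
Hypothesis d_moveV : forall s r th, s \in G -> r \in G -> th \in G -> D th ->
  (d (th * r)%g s <= d r s + c)%N.
Variables (g beta : 'S_n -> R).
Hypothesis beta0 : forall s, s \in G -> 0 <= beta s.
Hypothesis g_beta : forall r s, r \in G -> s \in G -> g r - g s <= beta r * (d r s)%:R.

Lemma Kbelow_n : Kbelow G n = K_ G.
Proof. by apply: eq_card => v; rewrite !inE ltn_ord. Qed.

Lemma fiber_from_n s0 : fiber G (from n n) s0 = G.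
Proof.
have -> : from n n = finset.set0 by apply/setP => w; rewrite !inE leqNgt ltn_ord.
exact: fiber_set0.
Qed.

Let B := sup_on G (fun s => beta s ^+ 2).

Lemma metric_tails (u : R) : 0 <= u ->
  Pr G mu (fun s => expect G mu g + u <= g s)
    <= exp_frac (2 * u ^+ 2) ((K_ G)%:R * c%:R ^+ 2 * B) /\
  Pr G mu (fun s => g s <= expect G mu g - u)
    <= exp_frac (2 * u ^+ 2)
         ((K_ G)%:R * c%:R ^+ 2 * Num.min B (4 * expect G mu (fun s => beta s ^+ 2))).
Proof.
move=> u0; have m0 := mass_prob prob_mu; have mu0 := prob_ge0 prob_mu.
have B0 : 0 <= B.
  by apply: le_trans (sup_on_ge (fun s => beta s ^+ 2) (group1 G)); rewrite sqr_ge0.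
pose L := Num.sqrt B; have L0 : 0 <= L := sqrtr_ge0 B.
have L2 : L ^+ 2 = B by rewrite sqr_sqrtr.
have bL s : s \in G -> beta s <= L.
  move=> sG; rewrite -(ler_pXn2r (ltn0Sn 1)) ?nnegrE ?beta0// L2.
  exact: (sup_on_ge (fun s => beta s ^+ 2) sG).
have gL r s : r \in G -> s \in G -> g r - g s <= L * (d r s)%:R.
  move=> rG sG; apply: le_trans (g_beta rG sG) _.
  by rewrite ler_wpM2r ?bL.
have K0 : 0 <= (K_ G)%:R * c%:R ^+ 2 :> R by rewrite mulr_ge0 ?sqr_ge0.
have scale (b : R) : exp_frac (2 * u ^+ 2) ((K_ G)%:R * c%:R ^+ 2 * b) =
    exp_frac (u ^+ 2) (4 * ((K_ G)%:R * c%:R ^+ 2 * b / 8)).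
  rewrite -[RHS](@exp_frac_scale _ 2)//; congr exp_frac; lra.
have lipschitz (d' : 'S_n -> 'S_n -> nat) X (x : R) : 0 <= x ->
    (forall s, s \in G -> d' s s = 0%N) ->
    (forall s r th, s \in G -> r \in G -> th \in G -> D th -> (d' s (th * r)%g <= d' s r + c)%N) ->
    (forall r s, r \in G -> s \in G -> X r - X s <= L * (d' r s)%:R) ->
    expect G mu (fun s => expR (x * X s)) <=
    expR (x * expect G mu X + x ^+ 2 * ((K_ G)%:R * c%:R ^+ 2 * B / 8)).
  move=> x0 d0 dm XL.
  have := @cexp_chain_lipschitz R n G mu mu0 D d' c tr d0 dm n 1%g (x * L) (fun s => x * X s)
    (leqnn n) (group1 G).
  rewrite fiber_from_n Kbelow_n => /(_ m0 (mulr_ge0 x0 L0)) H.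
  rewrite !(expectE prob_mu); apply: le_trans (H _) _.
    by move=> r s rG sG; rewrite -mulrBr -mulrA ler_wpM2l ?XL.
  by rewrite ler_expR cexpZ -L2; lra.
split.
  rewrite scale; apply: (Pr_upper prob_mu) => //; first by rewrite divr_ge0 ?mulr_ge0.
  by move=> x x0; apply: (lipschitz d).
(* The Lipschitz bound for [-g] holds with the arguments of [d] exchanged, whence the hypothesis
   [d_moveV]. *)
have low1 : Pr G mu (fun s => g s <= expect G mu g - u)
    <= exp_frac (2 * u ^+ 2) ((K_ G)%:R * c%:R ^+ 2 * B).
  rewrite scale; apply: (Pr_lower prob_mu) => //; first by rewrite divr_ge0 ?mulr_ge0.
  move=> x x0; have := lipschitz (fun s r => d r s) (fun s => - g s) x x0 d_refl.
  rewrite expectN mulrN; under eq_fun do rewrite mulrN.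
  apply; first by move=> s r th sG rG thG Dth; exact: d_moveV.
  by move=> r s rG sG; rewrite opprK addrC gL.
case: (leP B (4 * _)) => _ //.
have Eb0 : 0 <= expect G mu (fun s => beta s ^+ 2).
  by apply: sumr_ge0 => s sG; rewrite mulr_ge0 ?mu0 ?sqr_ge0.
rewrite scale; apply: (Pr_lower prob_mu) => //; first by rewrite divr_ge0 ?mulr_ge0.
move=> x x0.
(* With [b = false] only the mean of the penalty remains, and its constant 1/2 is 4/8. *)
have := @Lam_chain R n G mu mu0 D d c tr d_refl d_move false n 1%g (fun s => x * beta s)
  (fun s => x * g s) (fun s => x * g s) (leqnn n) (group1 G).
rewrite fiber_from_n Kbelow_n => H.
have xg : {in G &, forall s r, x * g s - x * g r <= x * beta s * (d s r)%:R}.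
  by move=> s r sG rG; rewrite -mulrBr -mulrA ler_wpM2l ?g_beta.
have /(mgfN_le_of_Lam prob_mu) := H (fun s sG => mulr_ge0 x0 (beta0 sG)) m0 xg.
move=> /le_trans; apply; rewrite ler_expR le_eqVlt; apply/orP; left; apply/eqP.
rewrite !(expectE prob_mu) (@eq_cexp _ _ _ _ _ (fun s => x * g s +
  (- (x ^+ 2 * ((K_ G)%:R * c%:R ^+ 2 / 2))) * beta s ^+ 2)); last by move=> s _; lra.
by rewrite cexpD !cexpZ; lra.
Qed.

End MetricTails.

Section Translatable.
Variables (R : realType) (n : nat) (G : {group 'S_n}).

Lemma translatableW (D D' : 'S_n -> Prop) (mu : 'S_n -> R) W v :
  (forall th, D th -> D' th) -> translatable G D mu W v -> translatable G D' mu W v.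
Proof.
move=> DD' tr s1 s2 s1G s21 m1 m2; have [th tth Dth] := tr s1 s2 s1G s21 m1 m2.
by exists th => //; exact: DD'.
Qed.

Lemma translatable_eq (D : 'S_n -> Prop) (mu mu' : 'S_n -> R) W v :
  {in G, mu =1 mu'} -> translatable G D mu W v -> translatable G D mu' W v.
Proof.
move=> e tr s1 s2; have eM W' s0 : mass (fiber G W' s0) mu' = mass (fiber G W' s0) mu.
  by apply: eq_bigr => s /fiberG sG; rewrite e.
rewrite !eM => s1G s21 m1 m2; have [th [thG eth emu] Dth] := tr s1 s2 s1G s21 m1 m2.
exists th => //; split=> // s sF; have sG := fiberG sF.
by rewrite !eM -!e ?groupM// emu.
Qed.

End Translatable.

Unset Implicit Arguments.

Theorem corollary1p2 (R : realType) (n l : nat) (n_ge2 : (2 <= n)%N)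
    (l_ge2 : (2 <= l)%N) (l_le_n : (l <= n)%N)
    (G : {group 'S_n}) (G_neq1 : G :!=: 1%g)
    (t : 'I_n -> 'I_n -> 'S_n) (base_t : local_base l G t)
    (mu : 'S_n -> R) (prob_mu : prob G mu) (mu_M : product_law G t mu)
    (g : 'S_n -> R) :
  (forall (d : 'S_n -> 'S_n -> nat) (c : nat),
    [\/ d = @dH n /\ c = minn (2 * l - 1) n,
        d = @dT n l G /\ c = 2%N,
        [/\ local_group l G, uniform G mu, d = @dH n & c = l] |
        [/\ local_group l G, uniform G mu, d = @dT n l G & c = 1%N]] ->
    forall beta : 'S_n -> R,
    (forall s, s \in G -> 0 <= beta s) ->
    (forall r s, r \in G -> s \in G -> g r - g s <= beta r * (d r s)%:R) ->
    forall u : R, 0 <= u ->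
      Pr G mu (fun s => expect G mu g + u <= g s)
        <= exp_frac (2 * u ^+ 2)
             ((K_ G)%:R * c%:R ^+ 2 * sup_on G (fun s => beta s ^+ 2))
      /\
      Pr G mu (fun s => g s <= expect G mu g - u)
        <= exp_frac (2 * u ^+ 2)
             ((K_ G)%:R * c%:R ^+ 2 *
              Num.min (sup_on G (fun s => beta s ^+ 2))
                      (4 * expect G mu (fun s => beta s ^+ 2))))
  /\
  (forall c_sq : R,
    [/\ local_group l G, uniform G mu & c_sq = 2 * (l%:R - 1) ^+ 2 + 2] \/
    [/\ (G <| [set: 'S_n])%g,
        forall s, s \in G -> mu s = mu s^-1%g,
        forall s x, s \in G -> mu s = mu (perm_comp (perm_comp x^-1%g s) x) &
        c_sq = 8 * (l%:R - 1) ^+ 2 + 2] ->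
    forall alpha : 'I_n -> 'S_n -> R,
    (forall k s, s \in G -> 0 <= alpha k s) ->
    (forall r s, r \in G -> s \in G ->
       g r - g s <= \sum_k alpha k r * (r k != s k)%:R) ->
    [/\ forall v lambda : R, 0 <= v -> 0 <= lambda ->
          Pr G mu (fun s => expect G mu g + v + lambda * c_sq * sqnorm alpha s / 2
                              <= g s)
            <= expR (- (lambda * v)),
        forall u : R, 0 <= u ->
          Pr G mu (fun s => g s <= expect G mu g - u)
            <= exp_frac (u ^+ 2) (2 * c_sq * expect G mu (sqnorm alpha)),
        forall u : R, 0 <= u ->
          Pr G mu (fun s => expect G mu g + u <= g s)
            <= exp_frac (u ^+ 2) (2 * c_sq * sup_on G (sqnorm alpha)) &
        forall M : R, 0 <= M ->
          (forall s, s \in G -> sqnorm alpha s <= M * g s) ->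
          forall u : R, 0 <= u ->
          Pr G mu (fun s => expect G mu g + u <= g s)
            <= exp_frac (u ^+ 2) (2 * c_sq * M * (expect G mu g + u))]).
Proof.
have l_gt0 : (0 < l)%N := ltnW l_ge2.
have n_gt0 : (0 < n)%N := ltnW n_ge2.
have l2 : 2 <= l%:R :> R by rewrite ler_nat.
have [nu [_ mu_nu]] := mu_M.
have trM (v : 'I_n) : translatable G (two_moves l G) mu (from n v.+1) v.
  exact: (product_translatable base_t mu_nu).
have trU mu' (W : {set 'I_n}) v : local_group l G -> uniform G mu' ->
    translatable G (fun th => (pdeg th <= l)%N) mu' W v by exact: uniform_translatable.
split.
  move=> d c cases beta beta0 gb u u0.
  have [D [tr d0 dm dmV]] : exists D, [/\
      forall v : 'I_n, translatable G D mu (from n v.+1) v,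
      forall s, s \in G -> d s s = 0%N,
      forall s r th, s \in G -> r \in G -> th \in G -> D th ->
        (d s (th * r)%g <= d s r + c)%N &
      forall s r th, s \in G -> r \in G -> th \in G -> D th ->
        (d (th * r)%g s <= d r s + c)%N].
    (* For [dT] with exchanged arguments, the way back from [th * r] to [r] is the move along the
       inverse of [th]. *)
    have moveV (th : 'S_n) (r : 'S_n) : r = (th^-1 * (th * r))%g by rewrite mulKg.
    have dTV s r th k : s \in G -> r \in G -> reach l G (th * r)%g r k ->
        (dT l G (th * r)%g s <= dT l G r s + k)%N.
      move=> sG rG thr; apply: dT_le; rewrite addnC; apply: reach_trans thr _.
      exact: (reach_dT base_t).
    case: cases => [[-> ->]|[-> ->]|[loc unif -> ->]|[loc unif -> ->]].
    - exists (two_moves l G); split=> //; first by move=> s _; exact: dHxx.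
        move=> s r th _ _ _ [thl _]; apply: leq_trans (dH_move _ _ _) _.
        by rewrite leq_add2l leq_min thl pdeg_le_n.
      move=> s r th _ _ _ [thl _]; rewrite !(dHC _ s); apply: leq_trans (dH_move _ _ _) _.
      by rewrite leq_add2l leq_min thl pdeg_le_n.
    - exists (two_moves l G); split=> //; first by move=> s _; exact: dTxx.
        move=> s r th sG rG thG Dth; apply: (dT_move base_t) => //.
        exact: two_moves_reach.
      move=> s r th sG rG thG Dth; apply: dTV => //; rewrite [X in reach _ _ _ X](moveV th r).
      by apply: two_moves_reach; [rewrite groupM|exact: two_movesV].
    - exists (fun th => (pdeg th <= l)%N); split=> [v|s _|s r th _ _ _ thl|s r th _ _ _ thl].
      + exact: trU.
      + exact: dHxx.
      + by apply: leq_trans (dH_move _ _ _) _; rewrite leq_add2l.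
      + by rewrite !(dHC _ s); apply: leq_trans (dH_move _ _ _) _; rewrite leq_add2l.
    - exists (fun th => (pdeg th <= l)%N).
      split=> [v|s _|s r th sG rG thG thl|s r th sG rG thG thl].
      + exact: trU.
      + exact: dTxx.
      + by apply: (dT_move base_t) => //; exact: reach1.
      + apply: dTV => //; rewrite [X in reach _ _ _ X](moveV th r).
        by apply: reach1; rewrite ?groupV// pdegV.
  exact: (metric_tails prob_mu tr d0 dm dmV beta0 gb u0).
move=> c_sq cases alpha alpha0 ga.
have [D [D_gt0 hmu hmuV le]] : exists D, [/\ (0 < D)%N, homogeneous G D mu,
    homogeneous G D (fun s => mu (s^-1)%g) & D%:R ^+ 2 <= c_sq].
  case: cases => [[loc unif ->]|[Gn muV muJ ->]].
    exists l; split=> // [W v _|W v _|].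
    - exact: trU.
    - by apply: trU => //; exact: uniform_inv.
    (* [2 (l - 1)^2 + 2 - l^2 = (l - 2)^2]. *)
    - by have := sqr_ge0 (l%:R - 2 : R); lra.
  have hmu : homogeneous G (2 * l - 1) mu.
    apply: homogeneous_conj => // [s x sG|v]; last by apply: translatableW (trM v) => th [].
    by rewrite (muJ s x^-1%g sG) /perm_comp invgK conjgE.
  exists (2 * l - 1)%N; split=> //; first by lia.
    by move=> W v vW; apply: translatable_eq (hmu W v vW) => s sG; exact: muV.
  have -> : (2 * l - 1)%:R = 2 * l%:R - 1 :> R by rewrite natrB ?natrM//; lia.
  (* [8 (l - 1)^2 + 2 - (2 l - 1)^2 = (2 l - 3)^2]. *)
  by have := sqr_ge0 (2 * l%:R - 3 : R); lra.
exact: (config_tails n_gt0 D_gt0 prob_mu hmu hmuV le alpha0 ga).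
Qed.
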